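(* Let $R$ and $S$ be associative rings and let ${}_SC_R$ be a semidualizing $(S,R)$-bimodule. An $R$-module $M$ belongs to $\mathcal{A}_C(R)$ if and only if there exists a complex of $R$-modules $$X=\ \cdots\to P_1\to P_0\to U^0\to U^1\to\cdots$$ satisfying the following conditions: (a) the complex $X$ is exact; (b) each $P_i$ is a projective $R$-module; (c) each $U^i$ is $C$-injective; (d) there is an isomorphism $M\cong\operatorname{Coker}(P_1\to P_0)$; and (e) the complex $C\otimes_RX$ is exact. The same equivalence holds with (b) replaced by the condition that each $P_i$ is a flat $R$-module. Moreover, if $M\in\mathcal{A}_C(R)$, then any complex $X=\ \cdots\to P_1\to P_0\to U^0\to U^1\to\cdots$ constructed by splicing together (along $P_0\to M\to U^0$) an augmented projective (respectively, flat) resolution of $M$ and an augmented proper $C$-injective coresolution of $M$ satisfies conditions (a)–(e) (with (b) in the projective, respectively flat, version); that is, $X$ is exact, each $P_i$ is a projective (respectively, flat) $R$-module, each $U^i$ is $C$-injective, $M\cong\operatorname{Coker}(P_1\to P_0)$, and $C\otimes_RX$ is exact.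
   Context: Rings are associative with unity (not necessarily commutative or noetherian). Modules are unital left modules; right $R$-modules are identified with left $R^{\mathrm{op}}$-modules. An $(S,R)$-bimodule $C={}_SC_R$ is semidualizing if: (a1) ${}_SC$ admits a degreewise finite $S$-projective resolution (a projective resolution by finitely generated projectives); (a2) $C_R$ admits a degreewise finite $R^{\mathrm{op}}$-projective resolution; (b1) the homothety map $S\to\operatorname{Hom}_{R^{\mathrm{op}}}(C,C)$, $s\mapsto(x\mapsto sx)$, is an isomorphism; (b2) the homothety map $R\to\operatorname{Hom}_S(C,C)$, $r\mapsto(x\mapsto xr)$, is an isomorphism; (c1) $\operatorname{Ext}_S^{i}(C,C)=0$ for all $i\geq1$; (c2) $\operatorname{Ext}_{R^{\mathrm{op}}}^{i}(C,C)=0$ for all $i\geq 1$. The Auslander class $\mathcal{A}_C(R)$ consists of all $R$-modules $M$ with (A1) $\operatorname{Tor}^R_i(C,M)=0$ for all $i\ge1$; (A2) $\operatorname{Ext}_S^i(C,C\otimes_RM)=0$ for all $i\ge1$; (A3) the natural map $\mu_M\colon M\to\operatorname{Hom}_S(C,C\otimes_RM)$, $m\mapsto(c\mapsto c\otimes m)$, is an isomorphism. An $R$-module is $C$-injective if it has the form $\operatorname{Hom}_S(C,I)$ (up to isomorphism) for some injective $S$-module $I$; $\mathcal{I}_C(R)$ is the class of these. An augmented proper $C$-injective coresolution of $M$ is a complex $U^+=\ 0\to M\to U^0\to U^1\to\cdots$ with all $U^i\in\mathcal{I}_C(R)$ such that $\operatorname{Hom}_R(U^+,W)$ is exact for every $W\in\mathcal{I}_C(R)$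 ($U^+$ itself is not required to be exact). An augmented projective (flat) resolution of $M$ is an exact complex $\cdots\to P_1\to P_0\to M\to0$ with all $P_i$ projective (flat). *)

(* Defs.v *)
From HB Require Import structures.
From mathcomp Require Import all_boot all_algebra.
From mathcomp Require Import boolp.
From mathcomp.multinomials Require Import freeg.

Set Implicit Arguments.
Unset Strict Implicit.
Unset Printing Implicit Defensive.

Import GRing.Theory.
Local Open Scope ring_scope.
Local Open Scope quotient_scope.

(* Rings are [pzRingType]s: associative and unital, the zero ring included.
   Left R-modules are [lmodType R]; right R-modules are [lmodType R^c], that is,
   left modules over the opposite ring. *)

Definition surj (T U : Type) (f : T -> U) := forall y, exists x, f x = y.

Definition exact_at (U V W : zmodType) (f : U -> V) (g : V -> W) :=
  (forall x, g (f x) = 0) /\ (forall y, g y = 0 -> exists x, f x = y).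

Definition lmod_iso (R : pzRingType) (M N : lmodType R) :=
  exists f : {linear M -> N}, bijective f.

Section Hom.
Context (R : pzRingType).
Implicit Types M N W : lmodType R.

Lemma linear_ext M N (f g : {linear M -> N}) : f =1 g -> f = g.
Proof.
case: f g => [f [[f1] [f2]]] [g [[g1] [g2]]] /= /funext fg.
by subst g; rewrite (Prop_irrelevance f1 g1) (Prop_irrelevance f2 g2).
Qed.

Section HomZmod.
Context (M N : lmodType R).
Implicit Types f g h : {linear M -> N}.

Definition hom_zero : {linear M -> N} := \0.
Definition hom_opp f : {linear M -> N} := \- f.
Definition hom_add f g : {linear M -> N} := f \+ g.

Fact hom_addA : associative hom_add.
Proof. by move=> f g h; apply: linear_ext => x /=; rewrite addrA. Qed.
Fact hom_addC : commutative hom_add.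
Proof. by move=> f g; apply: linear_ext => x /=; rewrite addrC. Qed.
Fact hom_add0 : left_id hom_zero hom_add.
Proof. by move=> f; apply: linear_ext => x /=; rewrite add0r. Qed.
Fact hom_addN : left_inverse hom_zero hom_opp hom_add.
Proof. by move=> f; apply: linear_ext => x /=; rewrite addNr. Qed.

HB.instance Definition _ := gen_eqMixin {linear M -> N}.
HB.instance Definition _ := gen_choiceMixin {linear M -> N}.
HB.instance Definition _ := GRing.isZmodule.Build {linear M -> N}
  hom_addA hom_addC hom_add0 hom_addN.

End HomZmod.

Definition hom_pre M N W (f : {linear M -> N}) (g : {linear N -> W}) :
  {linear M -> W} := g \o f.

Section Coker.
Context (M N : lmodType R) (f : {linear M -> N}).

Definition im_pred : pred N := fun y => `[< exists x, f x = y >].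

Fact im_zmod_closed : zmod_closed im_pred.
Proof.
split=> [|y z]; rewrite !unfold_in.
  by apply/asboolP; exists 0; rewrite raddf0.
move=> /asboolP[a <-] /asboolP[b <-].
by apply/asboolP; exists (a - b); rewrite raddfB.
Qed.
HB.instance Definition _ := GRing.isZmodClosed.Build N im_pred im_zmod_closed.
Definition im_closed : zmodClosed N := GRing.ZmodClosed.clone N im_pred _.

Definition coker : Type := Quotient.quot im_closed.
HB.instance Definition _ := GRing.Zmodule.on coker.

Definition coker_scale (a : R) (x : coker) : coker :=
  \pi_(Quotient.quot im_closed) (a *: repr (x : Quotient.quot im_closed)).

Fact coker_scale_pi a y :
  coker_scale a (\pi_(Quotient.quot im_closed) y) =
    \pi_(Quotient.quot im_closed) (a *: y).
Proof.
rewrite /coker_scale; apply/eqP; rewrite -Quotient.idealrBE -scalerBr.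
have : repr (\pi_(Quotient.quot im_closed) y) - y \in im_closed.
  by rewrite Quotient.idealrBE reprK.
rewrite !unfold_in => /asboolP[x fx]; apply/asboolP; exists (a *: x).
by rewrite linearZ fx.
Qed.

Fact coker_scaleA a b x :
  coker_scale a (coker_scale b x) = coker_scale (a * b) x.
Proof.
rewrite -[x](@reprK _ (Quotient.quot im_closed)).
by rewrite !coker_scale_pi scalerA.
Qed.
Fact coker_scale1 : left_id 1 coker_scale.
Proof.
move=> x; rewrite -[x](@reprK _ (Quotient.quot im_closed)).
by rewrite !coker_scale_pi scale1r.
Qed.
Fact coker_scaleDr : right_distributive coker_scale +%R.
Proof.
move=> a x y; rewrite -[x](@reprK _ (Quotient.quot im_closed)).
rewrite -[y](@reprK _ (Quotient.quot im_closed)).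
by rewrite -raddfD !coker_scale_pi scalerDr raddfD.
Qed.
Fact coker_scaleDl x : {morph coker_scale^~ x : a b / a + b}.
Proof.
move=> a b; rewrite -[x](@reprK _ (Quotient.quot im_closed)).
by rewrite !coker_scale_pi scalerDl raddfD.
Qed.
HB.instance Definition _ := GRing.Zmodule_isLmodule.Build R coker
  coker_scaleA coker_scale1 coker_scaleDr coker_scaleDl.

End Coker.
End Hom.

(* The tensor product of a right and a left R-module: the free abelian group on
   pairs modulo the biadditivity and balancing relations. *)
Section Tensor.
Context (R : pzRingType) (A : lmodType R^c) (M : lmodType R).

Local Notation F := {freeg (A * M)%type / int}.

Inductive tensor_rel : F -> Prop :=
| Tensor_rel0 : tensor_rel 0
| Tensor_relB x y : tensor_rel x -> tensor_rel y -> tensor_rel (x - y)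
| Tensor_relDl a b m :
    tensor_rel (<< (a + b, m) >> - << (a, m) >> - << (b, m) >>)
| Tensor_relDr a m n :
    tensor_rel (<< (a, m + n) >> - << (a, m) >> - << (a, n) >>)
| Tensor_relZ (r : R) a m :
    tensor_rel (<< ((r : R^c) *: a, m) >> - << (a, r *: m) >>).

Definition tensor_pred : pred F := fun x => `[< tensor_rel x >].

Fact tensor_zmod_closed : zmod_closed tensor_pred.
Proof.
split=> [|x y]; rewrite !unfold_in; first exact/asboolP/Tensor_rel0.
by move=> /asboolP Hx /asboolP Hy; exact/asboolP/Tensor_relB.
Qed.
HB.instance Definition _ :=
  GRing.isZmodClosed.Build F tensor_pred tensor_zmod_closed.
Definition tensor_closed : zmodClosed F :=
  GRing.ZmodClosed.clone F tensor_pred _.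

Definition tensor : Type := Quotient.quot tensor_closed.
HB.instance Definition _ := GRing.Zmodule.on tensor.

Definition tensor_pi (x : F) : tensor := \pi_(Quotient.quot tensor_closed) x.
Definition pure (a : A) (m : M) : tensor := tensor_pi << (a, m) >>.

Fact tensor_pi_is_zmod_morphism : zmod_morphism tensor_pi.
Proof. by move=> x y; rewrite /tensor_pi raddfB. Qed.
HB.instance Definition _ :=
  GRing.isZmodMorphism.Build F tensor tensor_pi tensor_pi_is_zmod_morphism.

Lemma tensor_pi0 x : tensor_rel x -> tensor_pi x = 0.
Proof.
move=> Hx; rewrite -(raddf0 tensor_pi).
by apply/eqP; rewrite /tensor_pi -Quotient.idealrBE subr0 unfold_in; apply/asboolP.
Qed.

Lemma pureDl a b m : pure (a + b) m = pure a m + pure b m.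
Proof.
apply/eqP; rewrite -subr_eq0 opprD addrA -!raddfB; apply/eqP.
exact/tensor_pi0/Tensor_relDl.
Qed.

Lemma pureDr a m n : pure a (m + n) = pure a m + pure a n.
Proof.
apply/eqP; rewrite -subr_eq0 opprD addrA -!raddfB; apply/eqP.
exact/tensor_pi0/Tensor_relDr.
Qed.

Lemma pureZ (r : R) a m : pure ((r : R^c) *: a) m = pure a (r *: m).
Proof.
apply/eqP; rewrite -subr_eq0 -raddfB; apply/eqP.
exact/tensor_pi0/Tensor_relZ.
Qed.

Lemma tensor_ext (G : zmodType) (f g : tensor -> G) :
  zmod_morphism f -> zmod_morphism g ->
  (forall a m, f (pure a m) = g (pure a m)) -> f =1 g.
Proof.
move=> fB gB fg x.
pose mf := GRing.isZmodMorphism.Build _ _ f fB.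
pose f' : {additive tensor -> G} := HB.pack f mf.
pose mg := GRing.isZmodMorphism.Build _ _ g gB.
pose g' : {additive tensor -> G} := HB.pack g mg.
rewrite -[f]/(f' : _ -> _) -[g]/(g' : _ -> _).
rewrite -[x](@reprK _ (Quotient.quot tensor_closed)).
rewrite -[\pi_ _ _]/(tensor_pi _).
rewrite -[repr _]freeg_sumE 3!raddf_sum; apply: eq_bigr => -[a m] _.
set c := coeff _ _.
have -> : << c *g (a, m) >> = << (a, m) >> *~ c :> F.
  by rewrite freegU_mulz intz.
by rewrite 3!raddfMz; congr (_ *~ _); exact: fg.
Qed.

Section Lift.
Context (G : zmodType) (B : A -> M -> G).

(* The additive map induced by [B]; meaningful only when [B] is biadditive and
   balanced. *)
Definition tensor_lift (x : tensor) : G :=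
  @fglift int (zmodule G) (A * M)%type (fun p => B p.1 p.2)
    (repr (x : Quotient.quot tensor_closed)).

Hypothesis BDl : forall a b m, B (a + b) m = B a m + B b m.
Hypothesis BDr : forall a m n, B a (m + n) = B a m + B a n.
Hypothesis BZ : forall (r : R) a m, B ((r : R^c) *: a) m = B a (r *: m).

Let L : F -> G := @fglift int (zmodule G) (A * M)%type (fun p => B p.1 p.2).

Let LB : {morph L : x y / x - y}.
Proof. exact: (@lift_is_additive int _ (zmodule G)). Qed.

Let LU a m : L << (a, m) >> = B a m.
Proof. by rewrite /L liftU scale1r. Qed.

Lemma tensor_lift_pi x : tensor_lift (tensor_pi x) = L x.
Proof.
rewrite /tensor_lift -/L; apply/eqP; rewrite -subr_eq0 -LB; apply/eqP.
set y := (_ - _); have : tensor_rel y.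
  apply/asboolP; rewrite -[`[< _ >]]/(y \in tensor_closed).
  by rewrite Quotient.idealrBE reprK.
elim=> [|u v _ Lu _ Lv|a b m|a m n|r a m].
- by have := LB 0 0; rewrite !subrr.
- by rewrite LB Lu Lv subrr.
- by rewrite !LB !LU BDl addrAC addrK subrr.
- by rewrite !LB !LU BDr addrAC addrK subrr.
- by rewrite LB !LU BZ subrr.
Qed.

Lemma tensor_lift_pure a m : tensor_lift (pure a m) = B a m.
Proof. by rewrite tensor_lift_pi LU. Qed.

Lemma tensor_lift_is_zmod_morphism : zmod_morphism tensor_lift.
Proof.
move=> x y; rewrite -[x](@reprK _ (Quotient.quot tensor_closed)).
rewrite -[y](@reprK _ (Quotient.quot tensor_closed)).
rewrite -![\pi_ _ _]/(tensor_pi _).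
by rewrite -(raddfB tensor_pi) !tensor_lift_pi LB.
Qed.

End Lift.
End Tensor.

Section TensorMap.
Context (R : pzRingType) (A A' : lmodType R^c) (M M' : lmodType R).
Context (f : {linear A -> A'}) (g : {linear M -> M'}).

Definition tensor_map : tensor A M -> tensor A' M' :=
  tensor_lift (fun a m => pure (f a) (g m)).

Let BDl a b m : pure (f (a + b)) (g m) = pure (f a) (g m) + pure (f b) (g m).
Proof. by rewrite raddfD pureDl. Qed.
Let BDr a m n : pure (f a) (g (m + n)) = pure (f a) (g m) + pure (f a) (g n).
Proof. by rewrite raddfD pureDr. Qed.
Let BZ (r : R) a m : pure (f ((r : R^c) *: a)) (g m) = pure (f a) (g (r *: m)).
Proof. by rewrite !linearZ pureZ. Qed.

Lemma tensor_map_pure a m : tensor_map (pure a m) = pure (f a) (g m).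
Proof. exact: tensor_lift_pure BDl BDr BZ a m. Qed.

Fact tensor_map_is_zmod_morphism : zmod_morphism tensor_map.
Proof. exact: tensor_lift_is_zmod_morphism BDl BDr BZ. Qed.
HB.instance Definition _ :=
  GRing.isZmodMorphism.Build _ _ tensor_map tensor_map_is_zmod_morphism.

End TensorMap.

(* (S,R)-bimodules: left S-modules with a commuting right R-action. *)
HB.mixin Record Lmodule_isBimodule (S R : pzRingType) C
    of GRing.Lmodule S C := {
  ract : C -> R -> C;
  ractA : forall x a b, ract (ract x a) b = ract x (a * b);
  ract1 : forall x, ract x 1 = x;
  ractDl : forall x y a, ract (x + y) a = ract x a + ract y a;
  ractDr : forall x a b, ract x (a + b) = ract x a + ract x b;
  ractZ : forall (s : S) x a, ract (s *: x) a = s *: ract x a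
}.

#[short(type="bimodType")]
HB.structure Definition Bimodule (S R : pzRingType) :=
  {C of Lmodule_isBimodule S R C & GRing.Lmodule S C}.

(* The right R-module underlying a bimodule. *)
Section RightModule.
Context (S R : pzRingType) (C : bimodType S R).

Definition rmod : Type := C.
HB.instance Definition _ := GRing.Zmodule.on rmod.

Definition rmod_scale (a : R^c) (x : rmod) : rmod := ract (x : C) a.

Fact rmod_scaleA a b x : rmod_scale a (rmod_scale b x) = rmod_scale (a * b) x.
Proof. exact: ractA. Qed.
Fact rmod_scale1 : left_id 1 rmod_scale.
Proof. exact: ract1. Qed.
Fact rmod_scaleDr : right_distributive rmod_scale +%R.
Proof. by move=> a x y; apply: ractDl. Qed.
Fact rmod_scaleDl x : {morph rmod_scale^~ x : a b / a + b}.
Proof. by move=> a b; apply: ractDr. Qed.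
HB.instance Definition _ := GRing.Zmodule_isLmodule.Build R^c rmod
  rmod_scaleA rmod_scale1 rmod_scaleDr rmod_scaleDl.

(* The homothety maps r |-> (x |-> x r) and s |-> (x |-> s x). *)
Definition rhomothety_fun (r : R) (x : C) : C := ract x r.
Fact rhomothety_is_linear r : linear (rhomothety_fun r).
Proof. by move=> s x y; rewrite /rhomothety_fun ractDl ractZ. Qed.
HB.instance Definition _ r :=
  GRing.isLinear.Build S C C *:%R (rhomothety_fun r) (rhomothety_is_linear r).
Definition rhomothety (r : R) : {linear C -> C} := rhomothety_fun r.

Definition lhomothety_fun (s : S) (x : rmod) : rmod := s *: (x : C).
Fact lhomothety_is_linear s : linear (lhomothety_fun s).
Proof.
move=> r x y; rewrite /lhomothety_fun scalerDr; congr (_ + _).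
exact: (esym (ractZ _ _ _)).
Qed.
HB.instance Definition _ s := GRing.isLinear.Build R^c rmod rmod *:%R
  (lhomothety_fun s) (lhomothety_is_linear s).
Definition lhomothety (s : S) : {linear rmod -> rmod} := lhomothety_fun s.

End RightModule.

(* Hom_S(C, N) as a left R-module: (r f)(c) = f(c r). *)
Section BimodHom.
Context (S R : pzRingType) (C : bimodType S R) (N : lmodType S).

Definition bhom : Type := {linear C -> N}.
HB.instance Definition _ := GRing.Zmodule.on bhom.

Definition bhom_scale (r : R) (f : bhom) : bhom :=
  hom_pre (rhomothety C r) f.

Fact bhom_scaleA a b f : bhom_scale a (bhom_scale b f) = bhom_scale (a * b) f.
Proof.
by apply: linear_ext => x /=; rewrite /rhomothety_fun ractA.
Qed.
Fact bhom_scale1 : left_id 1 bhom_scale.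
Proof. by move=> f; apply: linear_ext => x /=; rewrite /rhomothety_fun ract1. Qed.
Fact bhom_scaleDr : right_distributive bhom_scale +%R.
Proof. by move=> a f g; apply: linear_ext. Qed.
Fact bhom_scaleDl f : {morph bhom_scale^~ f : a b / a + b}.
Proof.
move=> a b; apply: linear_ext => x /=.
by rewrite /rhomothety_fun ractDr raddfD.
Qed.
HB.instance Definition _ := GRing.Zmodule_isLmodule.Build R bhom
  bhom_scaleA bhom_scale1 bhom_scaleDr bhom_scaleDl.

End BimodHom.

(* C (x)_R M as a left S-module: s (c (x) m) = (s c) (x) m. *)
Section BimodTensor.
Context (S R : pzRingType) (C : bimodType S R).

Section Module.
Context (M : lmodType R).

Definition btensor : Type := tensor (rmod C) M.
HB.instance Definition _ := GRing.Zmodule.on btensor.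

Definition btensor_scale (s : S) (x : btensor) : btensor :=
  tensor_map (lhomothety C s) idfun x.

Fact btensor_scale_pure s (c : rmod C) m :
  btensor_scale s (pure c m) = pure (lhomothety C s c) m.
Proof. exact: tensor_map_pure. Qed.

Fact btensor_scaleB s : zmod_morphism (btensor_scale s).
Proof. exact: tensor_map_is_zmod_morphism. Qed.

Fact btensor_scaleA a b x :
  btensor_scale a (btensor_scale b x) = btensor_scale (a * b) x.
Proof.
apply: (tensor_ext (f := btensor_scale a \o btensor_scale b)).
- by move=> y z /=; rewrite !btensor_scaleB.
- exact: btensor_scaleB.
move=> c m /=; rewrite !btensor_scale_pure; congr pure.
exact: (@scalerA S C).
Qed.
Fact btensor_scale1 : left_id 1 btensor_scale.
Proof.
apply: tensor_ext => //; first exact: btensor_scaleB.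
move=> c m /=; rewrite btensor_scale_pure; congr pure.
exact: (@scale1r S C).
Qed.
Fact btensor_scaleDr : right_distributive btensor_scale +%R.
Proof. by move=> s x y; rewrite /btensor_scale raddfD. Qed.
Fact btensor_scaleDl x : {morph btensor_scale^~ x : a b / a + b}.
Proof.
move=> a b.
apply: (tensor_ext (g := fun y => btensor_scale a y + btensor_scale b y)).
- exact: btensor_scaleB.
- by move=> y z /=; rewrite !btensor_scaleB opprD addrACA.
move=> c m /=; rewrite !btensor_scale_pure -pureDl; congr pure.
exact: (@scalerDl S C).
Qed.
HB.instance Definition _ := GRing.Zmodule_isLmodule.Build S btensor
  btensor_scaleA btensor_scale1 btensor_scaleDr btensor_scaleDl.

Definition mu_at (m : M) (c : C) : btensor := pure (c : rmod C) m.
Fact mu_at_is_linear m : linear (mu_at m).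
Proof.
move=> s x y; rewrite /mu_at [X in pure X m]/(s *: x + y) pureDl.
congr (_ + _); exact: (esym (btensor_scale_pure _ _ _)).
Qed.
HB.instance Definition _ m :=
  GRing.isLinear.Build S C btensor *:%R (mu_at m) (mu_at_is_linear m).

Definition mu_fun (m : M) : bhom C btensor := (mu_at m : {linear C -> btensor}).
Fact mu_is_linear : linear mu_fun.
Proof.
move=> r m n; apply: linear_ext => c /=; rewrite /mu_at pureDr; congr (_ + _).
exact: (esym (pureZ _ _ _)).
Qed.
HB.instance Definition _ :=
  GRing.isLinear.Build R M (bhom C btensor) *:%R mu_fun mu_is_linear.
Definition mu : {linear M -> bhom C btensor} := mu_fun.

End Module.

Section Map.
Context (M N : lmodType R) (f : {linear M -> N}).

Definition btensor_map_fun : btensor M -> btensor N :=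
  tensor_map (idfun : {linear rmod C -> rmod C}) f.
Fact btensor_map_is_linear : linear btensor_map_fun.
Proof.
move=> s x y; rewrite /btensor_map_fun raddfD; congr (_ + _).
move: x; apply: tensor_ext.
- by move=> x z; rewrite scalerBr raddfB.
- by move=> x z; rewrite raddfB scalerBr.
move=> c m; rewrite tensor_map_pure.
have -> : s *: (pure c m : btensor M) = pure (lhomothety C s c) m.
  exact: btensor_scale_pure.
rewrite [LHS]tensor_map_pure.
exact: (esym (btensor_scale_pure _ _ _)).
Qed.
HB.instance Definition _ := GRing.isLinear.Build S (btensor M) (btensor N) *:%R
  btensor_map_fun btensor_map_is_linear.
Definition btensor_map : {linear btensor M -> btensor N} := btensor_map_fun.

End Map.
End BimodTensor.

Section Classes.
Context (R : pzRingType).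

Definition projective (P : lmodType R) :=
  forall (A B : lmodType R) (f : {linear A -> B}) (g : {linear P -> B}),
    surj f -> exists h : {linear P -> A}, forall x, f (h x) = g x.

Definition injective_mod (I : lmodType R) :=
  forall (A B : lmodType R) (f : {linear A -> B}) (g : {linear A -> I}),
    injective f -> exists h : {linear B -> I}, forall x, h (f x) = g x.

Definition flat (P : lmodType R) :=
  forall (A B D : lmodType R^c) (f : {linear A -> B}) (g : {linear B -> D}),
    exact_at f g ->
    exact_at (tensor_map f (idfun : {linear P -> P}))
             (tensor_map g (idfun : {linear P -> P})).

Definition fin_gen (M : lmodType R) :=
  exists (n : nat) (e : 'I_n -> M),
    forall x, exists a : 'I_n -> R, x = \sum_(i < n) a i *: e i.

End Classes.

(* A complex ... -> L_1 -> L_0 -> M -> 0, with L_i = [lobj i]. *)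
Record laug_complex (R : pzRingType) (M : lmodType R) := LaugComplex {
  lobj : nat -> lmodType R;
  ldiff : forall n, {linear lobj n.+1 -> lobj n};
  laug : {linear lobj 0 -> M};
  ldiffK : forall n x, ldiff n (ldiff n.+1 x) = 0;
  laugK : forall x, laug (ldiff 0 x) = 0
}.

(* A complex 0 -> M -> U^0 -> U^1 -> ..., with U^i = [robj i]. *)
Record raug_complex (R : pzRingType) (M : lmodType R) := RaugComplex {
  robj : nat -> lmodType R;
  rdiff : forall n, {linear robj n -> robj n.+1};
  raug : {linear M -> robj 0};
  rdiffK : forall n x, rdiff n.+1 (rdiff n x) = 0;
  raugK : forall x, rdiff 0 (raug x) = 0
}.

(* A complex ... -> P_1 -> P_0 -> U^0 -> U^1 -> ..., with P_i = [cleft i] and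
   U^i = [cright i]. *)
Record complex (R : pzRingType) := Complex {
  cleft : nat -> lmodType R;
  cright : nat -> lmodType R;
  dleft : forall n, {linear cleft n.+1 -> cleft n};
  dmid : {linear cleft 0 -> cright 0};
  dright : forall n, {linear cright n -> cright n.+1};
  dleftK : forall n x, dleft n (dleft n.+1 x) = 0;
  dmidKl : forall x, dmid (dleft 0 x) = 0;
  dmidKr : forall x, dright 0 (dmid x) = 0;
  drightK : forall n x, dright n.+1 (dright n x) = 0
}.

Definition exact_complex (R : pzRingType) (X : complex R) :=
  [/\ forall n, exact_at (dleft X n.+1) (dleft X n),
      exact_at (dleft X 0) (dmid X),
      exact_at (dmid X) (dright X 0)
    & forall n, exact_at (dright X n) (dright X n.+1)].

Section Splice.
Context (R : pzRingType) (M : lmodType R).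
Context (P : laug_complex M) (U : raug_complex M).

Definition splice_mid : {linear lobj P 0 -> robj U 0} := raug U \o laug P.

Fact splice_midKl x : splice_mid (ldiff P 0 x) = 0.
Proof. by rewrite /= laugK raddf0. Qed.
Fact splice_midKr x : rdiff U 0 (splice_mid x) = 0.
Proof. by rewrite /= raugK. Qed.

Definition splice : complex R :=
  Complex (@ldiffK _ _ P) splice_midKl splice_midKr (@rdiffK _ _ U).

End Splice.

Section TensorComplex.
Context (S R : pzRingType) (C : bimodType S R) (X : complex R).

Fact btensor_map_comp0 (M N W : lmodType R)
    (f : {linear M -> N}) (g : {linear N -> W}) :
  (forall x, g (f x) = 0) ->
  forall x, btensor_map C g (btensor_map C f x) = 0.
Proof.
move=> gf0; apply: (tensor_ext (f := btensor_map C g \o btensor_map C f)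
  (g := fun=> 0)) => [x y|x y|c m] /=.
- by rewrite !raddfB.
- by rewrite subrr.
rewrite /btensor_map_fun !tensor_map_pure gf0 /=.
by apply: (addrI (pure (c : rmod C) 0)); rewrite -pureDr !addr0.
Qed.

(* C (x)_R X *)
Definition tensor_complex : complex S :=
  {| cleft := fun n => btensor C (cleft X n) : lmodType S;
     cright := fun n => btensor C (cright X n) : lmodType S;
     dleft := fun n => btensor_map C (dleft X n);
     dmid := btensor_map C (dmid X);
     dright := fun n => btensor_map C (dright X n);
     dleftK := fun n => btensor_map_comp0 (@dleftK _ X n);
     dmidKl := btensor_map_comp0 (@dmidKl _ X);
     dmidKr := btensor_map_comp0 (@dmidKr _ X);
     drightK := fun n => btensor_map_comp0 (@drightK _ X n) |}.

End TensorComplex.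

Section Resolutions.
Context (R : pzRingType).

Definition exact_laug (M : lmodType R) (P : laug_complex M) :=
  [/\ surj (laug P), exact_at (ldiff P 0) (laug P)
    & forall n, exact_at (ldiff P n.+1) (ldiff P n)].

(* Augmented resolutions by modules in the class [K]. *)
Definition resolution (K : lmodType R -> Prop) (M : lmodType R)
    (P : laug_complex M) :=
  (forall n, K (lobj P n)) /\ exact_laug P.

Definition degreewise_finite (M : lmodType R) :=
  exists P : laug_complex M,
    resolution (@projective R) P /\ forall n, fin_gen (lobj P n).

(* Ext_R^i(M, N) = 0 for all i >= 1, where Ext_R^i(M, N) = H^i(Hom_R(P, N)) for
   any projective resolution P of M; these always exist, and H^i does not depend
   on the choice. *)
Definition ext_vanishes (M N : lmodType R) :=
  forall P : laug_complex M, resolution (@projective R) P ->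
  forall n, exact_at (@hom_pre R _ _ N (ldiff P n))
                     (@hom_pre R _ _ N (ldiff P n.+1)).

(* Tor^R_i(A, M) = 0 for all i >= 1, where Tor^R_i(A, M) = H_i(A (x)_R P) for
   any projective resolution P of M, with the same proviso. *)
Definition tor_vanishes (A : lmodType R^c) (M : lmodType R) :=
  forall P : laug_complex M, resolution (@projective R) P ->
  forall n, exact_at (tensor_map (idfun : {linear A -> A}) (ldiff P n.+1))
                     (tensor_map (idfun : {linear A -> A}) (ldiff P n)).

End Resolutions.

Section Semidualizing.
Context (S R : pzRingType) (C : bimodType S R).

(* The homothety maps and [mu] are homomorphisms, so they are isomorphisms as
   soon as they are bijective. *)
Record semidualizing : Prop := Semidualizing {
  semidualizing_a1 : degreewise_finite (C : lmodType S);
  semidualizing_a2 : degreewise_finite (rmod C : lmodType R^c);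
  semidualizing_b1 : bijective (lhomothety C);
  semidualizing_b2 : bijective (rhomothety C);
  semidualizing_c1 : ext_vanishes (C : lmodType S) (C : lmodType S);
  semidualizing_c2 : ext_vanishes (rmod C : lmodType R^c) (rmod C : lmodType R^c)
}.

Record auslander (M : lmodType R) : Prop := Auslander {
  auslander_A1 : tor_vanishes (rmod C) M;
  auslander_A2 : ext_vanishes (C : lmodType S) (btensor C M);
  auslander_A3 : bijective (mu C M)
}.

Definition C_injective (U : lmodType R) :=
  exists I : lmodType S, injective_mod I /\ lmod_iso U (bhom C I).

(* Augmented proper C-injective coresolutions: each Hom_R(U^+, W) is exact, U^+
   itself need not be. *)
Definition proper_coresolution (M : lmodType R) (U : raug_complex M) :=
  (forall n, C_injective (robj U n)) /\
  forall W : lmodType R, C_injective W ->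
    [/\ surj (@hom_pre R _ _ W (raug U)),
        exact_at (@hom_pre R _ _ W (rdiff U 0)) (@hom_pre R _ _ W (raug U))
      & forall n, exact_at (@hom_pre R _ _ W (rdiff U n.+1))
                           (@hom_pre R _ _ W (rdiff U n))].

(* [K] is the class (projective or flat modules) required of the P_i. *)
Definition complete_resolution (K : lmodType R -> Prop) (M : lmodType R)
    (X : complex R) :=
  [/\ exact_complex X,
      forall n, K (cleft X n),
      forall n, C_injective (cright X n),
      lmod_iso M (coker (dleft X 0))
    & exact_complex (tensor_complex C X)].

End Semidualizing.

(* Main.v *)
(* For an injective S-module I, the evaluation C (x) Hom_S(C, I) -> I is an
   isomorphism, because C_R is finitely presented with endomorphism ring S.
   Hence, for a C-injective module U, the map mu_U is an isomorphism and C (x) U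
   is injective.

   Let U^+ = 0 -> M -> U^0 -> U^1 -> ... have C-injective terms. If C (x) U^+ is
   exact, it is an injective coresolution of C (x) M, and Hom_S(C, C (x) U^+) is
   U^+ with M replaced by Hom_S(C, C (x) M). So exactness of U^+ says precisely
   that Ext_S^i(C, C (x) M) = 0 for i >= 1 and that mu_M is an isomorphism. If
   U^+ is proper, C (x) U^+ is exact by adjunction, since
   Hom_R(U^+, Hom_S(C, I)) = Hom_S(C (x) U^+, I) for all injective I.

   A flat resolution F of M computes Tor: the characters of C (x) F form the
   complex Hom_R(F, C^+), where C^+ = Hom_Z(C, Q/Z). The characters of a
   resolution of C_R by finitely generated projectives form an injective
   coresolution of C^+ on which each Hom_R(F_i, -) is exact, and balancing Hom
   gives a criterion for the vanishing of Tor that does not depend on F. *)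
From HB Require Import structures.
From mathcomp Require Import all_boot all_algebra.
From mathcomp Require Import boolp classical_sets functions.
From mathcomp.multinomials Require Import freeg.
Require Import Defs.

Set Implicit Arguments.
Unset Strict Implicit.
Unset Printing Implicit Defensive.

Import GRing.Theory Num.Theory.
Local Open Scope ring_scope.
Local Open Scope quotient_scope.

(** * Bundling functions as linear or additive maps *)

Section BuildLinear.
Context (R : pzRingType) (M N : lmodType R) (f : M -> N) (fL : linear f).
Definition linear_of : {linear M -> N} :=
  HB.pack_for {linear M -> N} f (GRing.isLinear.Build R M N *:%R f fL).
Lemma linear_ofE x : linear_of x = f x.
Proof. by []. Qed.
End BuildLinear.

Section BuildAdditive.
Context (M N : zmodType) (f : M -> N) (fB : zmod_morphism f).
Definition additive_of : {additive M -> N} :=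
  HB.pack_for {additive M -> N} f (GRing.isZmodMorphism.Build M N f fB).
End BuildAdditive.

(** * Characters with values in Q/Z *)

Definition rat_int : pred rat := fun q => `[< exists z : int, z%:~R = q >].

Fact rat_int_zmod_closed : zmod_closed rat_int.
Proof.
split=> [|x y]; rewrite !unfold_in; first by apply/asboolP; exists 0.
move=> /asboolP[a <-] /asboolP[b <-]; apply/asboolP; exists (a - b).
by rewrite rmorphB.
Qed.
HB.instance Definition _ :=
  GRing.isZmodClosed.Build rat rat_int rat_int_zmod_closed.
Definition rat_int_closed : zmodClosed rat :=
  GRing.ZmodClosed.clone rat rat_int _.

Definition QZ : Type := Quotient.quot rat_int_closed.
HB.instance Definition _ := GRing.Zmodule.on QZ.

Definition QZ_pi (q : rat) : QZ := \pi_(Quotient.quot rat_int_closed) q.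

Fact QZ_pi_is_zmod_morphism : zmod_morphism QZ_pi.
Proof. by move=> x y; rewrite /QZ_pi raddfB. Qed.
HB.instance Definition _ :=
  GRing.isZmodMorphism.Build rat QZ QZ_pi QZ_pi_is_zmod_morphism.

Lemma QZ_piK (d : QZ) : exists q, QZ_pi q = d.
Proof.
by exists (repr (d : Quotient.quot rat_int_closed)); rewrite /QZ_pi reprK.
Qed.

Lemma QZ_pi_eq0 q : QZ_pi q = 0 <-> exists z : int, z%:~R = q.
Proof.
rewrite -(raddf0 QZ_pi); split=> [/eqP|H].
  by rewrite /QZ_pi -Quotient.idealrBE subr0 unfold_in => /asboolP.
by apply/eqP; rewrite /QZ_pi -Quotient.idealrBE subr0 unfold_in; apply/asboolP.
Qed.

Lemma QZ_divisible (d : QZ) (m : nat) : (0 < m)%N -> exists e, e *+ m = d.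
Proof.
move=> m0; have [q <-] := QZ_piK d; exists (QZ_pi (q / m%:R)).
by rewrite -raddfMn -[_ *+ m]mulr_natr divfK // pnatr_eq0 -lt0n.
Qed.

(** Witnesses are the classes of 1/m for m >= 2 and of 1/2 for m = 0, where the equation is vacuous.
    In [char_separation], m = 0 stands for infinite order. *)
Lemma QZ_torsion (m : nat) : m != 1%N -> exists2 d : QZ, d != 0 & d *+ m = 0.
Proof.
have key n : (1 < n)%N -> QZ_pi n%:R^-1 != 0.
  move=> n1; apply/eqP => /QZ_pi_eq0[z zE].
  have n0 : (n%:R : rat) != 0 by rewrite pnatr_eq0 -lt0n ltnW.
  have : (z * n%:Z)%:~R = 1%:~R :> rat.
    by rewrite rmorphM /= zE mulVf.
  move=> /intr_inj /(congr1 absz); rewrite abszM /= => /eqP.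
  by rewrite muln_eq1 => /andP[_ /eqP n1']; rewrite n1' in n1.
case: m => [|[//|m]] _; first by exists (QZ_pi 2%:R^-1); rewrite ?key.
exists (QZ_pi m.+2%:R^-1); first exact: key.
rewrite -raddfMn; apply/QZ_pi_eq0; exists 1.
by rewrite -[_ *+ m.+2]mulr_natr mulVf // pnatr_eq0.
Qed.

(** Division with remainder by the least positive element of the subgroup; if there is no positive
    element, the generator is 0. *)
Lemma int_subgroup_dvdz (P : int -> Prop) :
  P 0 -> (forall a b, P a -> P b -> P (a - b)) ->
  exists m : nat, forall k, P k <-> (m %| k)%Z.
Proof.
move=> P0 PB.
have PN a : P a -> P (- a) by rewrite -sub0r; apply: PB.
have PD a b : P a -> P b -> P (a + b).
  by rewrite -{2}[b]opprK => ? /PN; apply: PB.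
have PM a (k : int) : P a -> P (a * k).
  move=> Pa; have Pn (n : nat) : P (a * n%:Z).
    by elim: n => [|n IH]; rewrite ?mulr0 // intS mulrDr mulr1; apply: PD.
  by case: k => n; [exact: Pn | rewrite NegzE mulrN; apply/PN/Pn].
have [exm|nom] := pselect (exists m : nat, (0 < m)%N && `[< P m%:Z >]).
  case: (ex_minnP exm) => m /andP[m0 /asboolP Pm] minm; exists m => k; split.
    move=> Pk; rewrite (divz_eq k m) in Pk *.
    set r := (k %% m)%Z; have Pr : P r.
      have := PB _ _ Pk (PM _ (k %/ m)%Z Pm).
      by rewrite [_ * m%:Z]mulrC addrC addKr.
    have mn0 : m%:Z != 0 by rewrite eqz_nat -lt0n.
    have r0 : 0 <= r by rewrite modz_ge0.
    have : r < m%:Z by rewrite ltz_mod.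
    rewrite dvdzE/=.
    case: r Pr r0 => // n Pn _ nm.
    case: n Pn nm => [|n] Pn nm; first by rewrite addr0 abszM /= dvdn_mull.
    have := minm n.+1; rewrite /= (asboolT Pn) => /(_ isT).
    by rewrite leqNgt -ltz_nat nm.
  by move=> /dvdzP[q ->]; rewrite mulrC; apply: PM.
exists 0%N => k; rewrite dvd0z; split=> [Pk|/eqP-> //].
apply: contrapT => /negP k0; apply: nom; exists `|k|%N.
rewrite absz_gt0 k0 /=; apply/asboolP.
by case: k Pk {k0} => n //= /PN; rewrite NegzE opprK.
Qed.

(** * Extension of partially defined characters by Zorn's lemma *)

Section GraphExtension.
Context (Z : zmodType).
Implicit Types G H : set (Z * QZ).

(** The graph of a homomorphism from a subgroup of [Z] to Q/Z: as [G] is closed under differences,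
    it is single-valued as soon as 0 is its only value at 0. *)
Definition partial_char G : Prop :=
  [/\ G (0, 0),
      forall x y a b, G (x, a) -> G (y, b) -> G (x - y, a - b)
    & forall a, G (0, a) -> a = 0].

Section PartialChar.
Context G (hG : partial_char G).

Lemma partial_charN x a : G (x, a) -> G (- x, - a).
Proof.
by move=> Gx; rewrite -[- x]sub0r -[- a]sub0r; case: hG => G0 + _; apply.
Qed.

Lemma partial_charD x y a b : G (x, a) -> G (y, b) -> G (x + y, a + b).
Proof.
move=> Gx /partial_charN Gy; rewrite -[y]opprK -[b]opprK.
by case: hG => _ + _; apply.
Qed.

Lemma partial_charMz x a (k : int) : G (x, a) -> G (x *~ k, a *~ k).
Proof.
move=> Gx; have Gn (n : nat) : G (x *~ n, a *~ n).
  elim: n => [|n IH]; first by rewrite !mulr0z; case: hG.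
  by rewrite intS !mulrzDr !mulr1z; apply: partial_charD.
by case: k => n; [exact: Gn | rewrite NegzE !mulrNz; apply/partial_charN/Gn].
Qed.

(** The multiples of [z] in the domain are those by the multiples of some m. By divisibility of Q/Z
    there is a [d] with [d *~ m] the prescribed value at [z *~ m], and sending [z] to [d] is then
    consistent. *)
Lemma partial_char_extend z : exists H,
  [/\ partial_char H, (G `<=` H)%classic & exists d, H (z, d)].
Proof.
have [G0 GB Gf] := hG.
have [||m mP] := @int_subgroup_dvdz (fun k => exists d, G (z *~ k, d)).
- by exists 0; rewrite mulr0z.
- by move=> k l [d Gd] [e Ge]; exists (d - e); rewrite mulrzBr; apply: GB.
have [d dP] : exists d, G (z *~ m, d *~ m).
  have /mP[e Ge] : (m%:Z %| m%:Z)%Z by [].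
  (* For m = 0 no nonzero multiple of [z] lies in the domain, and any value at [z] would do. *)
  case: m mP Ge => [|m] mP Ge; first by exists 0; rewrite !mulr0z.
  have [//|d dE] := @QZ_divisible e m.+1.
  by exists d; rewrite -[d *~ _]pmulrn dE.
exists [set u | exists k : int, G (u.1 - z *~ k, u.2 - d *~ k)]%classic; split.
- split=> /=.
  + by exists 0; rewrite !mulr0z !subr0.
  + move=> x y a b [k Gk] [l Gl]; exists (k - l).
    rewrite !mulrzBr !opprB.
    have -> : x - y + (z *~ l - z *~ k) = x - z *~ k - (y - z *~ l).
      by rewrite opprB addrACA [RHS]addrACA [X in _ + X = _]addrC.
    have -> : a - b + (d *~ l - d *~ k) = a - d *~ k - (b - d *~ l).
      by rewrite opprB addrACA [RHS]addrACA [X in _ + X = _]addrC.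
    exact: GB.
  move=> a [k]; rewrite sub0r => Gk.
  have /mP/dvdzP[l lE] : exists e, G (z *~ k, e).
    by exists (- (a - d *~ k)); rewrite -[z *~ k]opprK; apply: partial_charN.
  have := partial_charD Gk (partial_charMz l dP).
  by rewrite -!mulrzA [_ * l]mulrC -lE addNr subrK => /Gf.
- by move=> [x a] Gx; exists 0; rewrite /= !mulr0z !subr0.
by exists d, 1; rewrite /= !mulr1z !subrr.
Qed.

End PartialChar.

Lemma partial_char_total G : partial_char G ->
  exists f : {additive Z -> QZ}, forall x a, G (x, a) -> f x = a.
Proof.
(* The empty chain must have an upper bound too. Adjoining [G] makes [P] true of its union, the
   empty set, and ensures that the final graph extends [G]. *)
move=> hG; pose P (A : set (Z * QZ)) := partial_char (A `|` G)%classic.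
have [|A [PA maxA]] := @Zorn_bigcup _ P.
  move=> F FP tot; split=> [|x y a b|a].
  - by right; case: hG.
  - have step X : P X -> (X `|` G)%classic (x, a) -> (X `|` G)%classic (y, b) ->
      (X `|` G)%classic (x - y, a - b) by case=> _ + _; apply.
    have sub X : F X -> (X `|` G)%classic (x - y, a - b) ->
      ((\bigcup_(X in F) X) `|` G)%classic (x - y, a - b).
      by move=> FX [Xu|Gu]; [left; exists X|right].
    move=> [[X FX Xx]|Gx] [[Y FY Yy]|Gy].
    + have [XY|YX] := tot _ _ FX FY.
        by apply: (sub Y) => //; apply: step (FP _ FY) _ _; left => //;
          apply: XY.
      by apply: (sub X) => //; apply: step (FP _ FX) _ _; left => //; apply: YX.
    + by apply: (sub X) => //; apply: step (FP _ FX) _ _; [left|right].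
    + by apply: (sub Y) => //; apply: step (FP _ FY) _ _; [right|left].
    + by right; case: hG => _ + _; apply.
  - case=> [[X FX Xa]|]; last by case: hG => _ _; apply.
    by have [_ _] := FP _ FX; apply; left.
pose B : set (Z * QZ) := (A `|` G)%classic.
(* By maximality, extending [B] to [z] adds nothing, so [z] is in its domain already. *)
have totB z : exists a, B (z, a).
  have [H [hH BH [d Hd]]] := @partial_char_extend B PA z.
  have [HB|nHB] := pselect (H `<=` B)%classic; first by exists d; apply: HB.
  exfalso; apply: (maxA H).
    split=> [u Au|E]; first by apply: BH; left.
    by apply: nHB => u /E Au; left.
  suff -> : P H = partial_char H by [].
  rewrite /P; congr partial_char; apply/seteqP; split=> u; last by left.
  by case=> // Gu; apply: BH; right.
have [f fB] := choice totB.
have Bf x a b : B (x, a) -> B (x, b) -> a = b.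
  case: PA => _ BB B0 Ba Bb; apply/eqP; rewrite -subr_eq0; apply/eqP/B0.
  by rewrite -(subrr x); apply: BB.
have fadd : zmod_morphism f.
  move=> x y; case: (PA) => _ BB _.
  exact: (Bf _ _ _ (fB _) (BB _ _ _ _ (fB x) (fB y))).
exists (additive_of fadd) => x a Gx.
by apply: (Bf _ _ _ (fB _)); right.
Qed.
End GraphExtension.

Section Characters.
Context (X Y Z : zmodType).

(** The assumption on kernels makes the pairs (g y, c y) a partial character on the image of [g],
    which extends to all of [Z]. For injective [g] this is the injectivity of Q/Z. *)
Lemma char_factor (g : {additive Y -> Z}) (c : {additive Y -> QZ}) :
  (forall y, g y = 0 -> c y = 0) ->
  exists d : {additive Z -> QZ}, forall y, d (g y) = c y.
Proof.
move=> gc.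
have [|d dP] := @partial_char_total Z
    (fun u => exists y, u = (g y, c y)); last first.
  by exists d => y; apply: dP; exists y.
split=> [|x y a b [u [-> ->]] [v [-> ->]]|a [y [g0 ->]]].
- by exists 0; rewrite !raddf0.
- by exists (u - v); rewrite !raddfB.
- exact: gc.
Qed.

(** If the multiples of [y] in the image of [f] are those by the multiples of m, then m is not 1.
    Sending the image to 0 and [y] to a nonzero element killed by m is a partial character. *)
Lemma char_separation (f : {additive X -> Y}) y : ~ (exists x, f x = y) ->
  exists c : {additive Y -> QZ}, (forall x, c (f x) = 0) /\ c y <> 0.
Proof.
move=> yf.
have [||m mP] := @int_subgroup_dvdz (fun k => exists x, f x = y *~ k).
- by exists 0; rewrite raddf0 mulr0z.
- by move=> k l [u fu] [v fv]; exists (u - v); rewrite raddfB fu fv mulrzBr.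
have m1 : m != 1%N.
  by apply/eqP => m1; apply: yf; have /mP : (m %| 1)%Z; rewrite ?m1.
have [d d0 dm] := QZ_torsion m1.
have [|c cP] := @partial_char_total Y
    (fun u => exists x (k : int), u = (f x + y *~ k, d *~ k)).
  split=> [|_ _ _ _ [u [k [-> ->]]] [v [l [-> ->]]]|a [x [k [e ->]]]].
  - by exists 0, 0; rewrite raddf0 !mulr0z addr0.
  - by exists (u - v), (k - l); rewrite raddfB !mulrzBr opprD addrACA.
  have /mP/dvdzP[l ->] : exists x, f x = y *~ k.
    exists (- x); rewrite raddfN; apply/eqP.
    by rewrite eq_sym -addr_eq0 addrC -e.
  by rewrite mulrC mulrzA -pmulrn dm mul0rz.
exists c; split=> [x|].
  by apply: cP; exists x, 0; rewrite !mulr0z addr0.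
suff -> : c y = d by exact/eqP.
by apply: cP; exists 0, 1; rewrite raddf0 add0r !mulr1z.
Qed.

(* Q/Z is an injective cogenerator of abelian groups. *)
Lemma exact_at_char (f : {additive X -> Y}) (g : {additive Y -> Z}) :
  (forall x, g (f x) = 0) ->
  exact_at f g <->
    forall c : {additive Y -> QZ}, (forall x, c (f x) = 0) ->
      exists d : {additive Z -> QZ}, forall y, d (g y) = c y.
Proof.
move=> gf; split=> [[_ fg] c cf|H].
  by apply: char_factor => y /fg[x <-].
split=> // y gy; apply: contrapT => /char_separation[c [cf]]; apply.
by have [d <-] := H _ cf; rewrite gy raddf0.
Qed.

End Characters.

Lemma linear_ker0_inj (R : pzRingType) (M N : lmodType R)
    (f : {linear M -> N}) :
  (forall x, f x = 0 -> x = 0) <-> injective f.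
Proof.
split=> [f0 x y /eqP|fI x]; last by rewrite -(raddf0 f) => /fI.
by rewrite -subr_eq0 -raddfB => /eqP/f0/eqP; rewrite subr_eq0 => /eqP.
Qed.

(** * Kernels, cokernels and lifting *)

Section Kernel.
Context (R : pzRingType) (M N : lmodType R) (f : {linear M -> N}).

Definition ker_pred : pred M := fun x => f x == 0.
Fact ker_submod_closed : submod_closed ker_pred.
Proof.
split=> [|a x y]; rewrite !unfold_in ?raddf0 // => /eqP fx /eqP fy.
by rewrite linearP fx fy scaler0 addr0.
Qed.
HB.instance Definition _ :=
  GRing.isSubmodClosed.Build R M ker_pred ker_submod_closed.

Record kernel : Type :=
  Kernel { kernel_val : M; kernelP : kernel_val \in ker_pred }.
HB.instance Definition _ := [isSub for kernel_val].
HB.instance Definition _ := [Choice of kernel by <:].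
HB.instance Definition _ := [SubChoice_isSubLmodule of kernel by <:].

Definition kernel_incl : {linear kernel -> M} := val.

Lemma kernel_inclK x : f (kernel_incl x) = 0.
Proof. by apply/eqP; have := kernelP x. Qed.

Lemma kernel_incl_inj : injective kernel_incl.
Proof. exact: val_inj. Qed.

Lemma kernel_exists x : f x = 0 -> exists k, kernel_incl k = x.
Proof. by move=> /eqP fx; exists (@Kernel x fx). Qed.

Lemma kernel_lift (L : lmodType R) (g : {linear L -> M}) :
  (forall x, f (g x) = 0) ->
  exists h : {linear L -> kernel}, forall x, kernel_incl (h x) = g x.
Proof.
move=> fg; have fg' x : g x \in ker_pred by apply/eqP/fg.
have hL : linear (fun x => Kernel (fg' x)).
  by move=> a x y; apply: val_inj; rewrite /= linearP.
by exists (linear_of hL).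
Qed.
End Kernel.

Section CokerTheory.
Context (R : pzRingType) (M N : lmodType R) (f : {linear M -> N}).

Definition coker_pi_fun (y : N) : coker f :=
  \pi_(Quotient.quot (im_closed f)) y.
Fact coker_pi_is_linear : linear coker_pi_fun.
Proof.
move=> a x y; rewrite /coker_pi_fun raddfD; congr (_ + _).
exact: esym (coker_scale_pi f a x).
Qed.
Definition coker_pi : {linear N -> coker f} := linear_of coker_pi_is_linear.

Lemma coker_pi_surj : surj coker_pi.
Proof.
move=> x; exists (repr (x : Quotient.quot (im_closed f))).
by rewrite linear_ofE /coker_pi_fun reprK.
Qed.

Lemma coker_pi_eq0 y : coker_pi y = 0 <-> exists x, f x = y.
Proof.
rewrite -(raddf0 coker_pi); split=> [/eqP|H].
  by rewrite -Quotient.idealrBE subr0 unfold_in => /asboolP.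
by apply/eqP; rewrite -Quotient.idealrBE subr0 unfold_in; apply/asboolP.
Qed.

End CokerTheory.

Section Descent.
Context (R : pzRingType).
Implicit Types A B L M N P I : lmodType R.

Lemma surj_descend A B N (p : {linear A -> B}) (g : {linear A -> N}) :
  surj p -> (forall x, p x = 0 -> g x = 0) ->
  exists h : {linear B -> N}, forall x, h (p x) = g x.
Proof.
move=> /choice[s sP] pg.
have gs x : g (s (p x)) = g x.
  have := pg (s (p x) - x); rewrite !linearB sP subrr.
  by move=> /(_ erefl)/eqP; rewrite subr_eq0 => /eqP.
have hL : linear (fun y => g (s y)).
  by move=> a x y; have := gs (a *: s x + s y); rewrite !linearP !sP.
by exists (linear_of hL) => x; rewrite linear_ofE gs.
Qed.

Lemma inj_corestrict A B N (i : {linear A -> B}) (g : {linear N -> B}) :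
  injective i -> (forall x, exists y, i y = g x) ->
  exists h : {linear N -> A}, forall x, i (h x) = g x.
Proof.
move=> iI /choice[s sP].
have hL : linear s by move=> a x y; apply: iI; rewrite linearP !sP linearP.
by exists (linear_of hL) => x; apply: sP.
Qed.

Lemma bijective_linear_inv A B (f : {linear A -> B}) : bijective f ->
  exists g : {linear B -> A}, cancel f g /\ cancel g f.
Proof.
move=> [g fK gK].
have gL : linear g by move=> a x y; apply: (can_inj fK); rewrite linearP !gK.
by exists (linear_of gL).
Qed.

Lemma lmod_iso_sym A B : lmod_iso A B -> lmod_iso B A.
Proof.
by move=> [f /bijective_linear_inv[g [fK gK]]]; exists g; exists f.
Qed.

Lemma inj_surj_bijective (T U : Type) (f : T -> U) :
  injective f -> surj f -> bijective f.
Proof.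
by move=> fI /choice[g fg]; exists g => // x; apply: fI; rewrite fg.
Qed.

(** By exactness [f] maps onto the kernel of [g], where [h] takes its values. *)
Lemma projective_lift P A B N (f : {linear A -> B}) (g : {linear B -> N})
    (h : {linear P -> B}) : projective P -> exact_at f g ->
  (forall x, g (h x) = 0) ->
  exists k : {linear P -> A}, forall x, f (k x) = h x.
Proof.
move=> projP [gf fg] gh.
have [f' f'P] := kernel_lift gf; have [h' h'P] := kernel_lift gh.
have [|k kP] := projP _ _ f' h'.
  move=> y; have [x xy] := fg _ (kernel_inclK y); exists x.
  by apply: kernel_incl_inj; rewrite f'P.
by exists k => x; rewrite -f'P kP.
Qed.

(** Dual to [projective_lift]: [g] embeds the cokernel of [f], and [h] factors through that
    cokernel. *)
Lemma injective_extend I A B N (f : {linear A -> B}) (g : {linear B -> N})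
    (h : {linear B -> I}) : injective_mod I -> exact_at f g ->
  (forall x, h (f x) = 0) ->
  exists k : {linear N -> I}, forall x, k (g x) = h x.
Proof.
move=> injI [gf fg] hf.
have [|g' g'P] := surj_descend (@coker_pi_surj _ _ _ f) (g := g).
  by move=> y /coker_pi_eq0[x <-].
have [|h' h'P] := surj_descend (@coker_pi_surj _ _ _ f) (g := h).
  by move=> y /coker_pi_eq0[x <-].
have [|k kP] := injI _ _ g' h'.
  apply/linear_ker0_inj => z; have [y <-] := coker_pi_surj z.
  by rewrite g'P => /fg[x <-]; apply/coker_pi_eq0; exists x.
by exists k => y; rewrite -g'P kP h'P.
Qed.

Lemma lmod_iso_injective A B : lmod_iso A B -> injective_mod B ->
  injective_mod A.
Proof.
move=> [u /bijective_linear_inv[v [uK vK]]] injB X Y f g fI.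
have [k kP] := injB _ _ f (hom_pre g u) fI.
by exists (hom_pre k v) => x /=; rewrite kP /= uK.
Qed.
End Descent.

Lemma additive_ext (M N : zmodType) (f g : {additive M -> N}) : f =1 g -> f = g.
Proof.
case: f g => [f [[f1]]] [g [[g1]]] /= /funext fg.
by subst g; rewrite (Prop_irrelevance f1 g1).
Qed.

(* The character module Hom_Z(A, Q/Z) of a right module A: (r f)(a) = f(a r). *)
Section Dual.
Context (R : pzRingType) (A : lmodType R^c).

Definition dual : Type := {additive A -> QZ}.
HB.instance Definition _ := gen_eqMixin dual.
HB.instance Definition _ := gen_choiceMixin dual.

Definition dual_app (c : dual) : {additive A -> QZ} := c.

Fact dual_zero_sub : zmod_morphism (fun _ : A => 0 : QZ).
Proof. by move=> x y; rewrite subrr. Qed.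
Fact dual_opp_sub (f : dual) : zmod_morphism (fun x => - dual_app f x).
Proof. by move=> x y; rewrite raddfB !opprB opprK addrC. Qed.
Fact dual_add_sub (f g : dual) :
  zmod_morphism (fun x => dual_app f x + dual_app g x).
Proof. by move=> x y; rewrite !raddfB opprD addrACA. Qed.
Fact dual_scale_sub (r : R) (f : dual) :
  zmod_morphism (fun x => dual_app f ((r : R^c) *: x)).
Proof. by move=> x y; rewrite scalerBr raddfB. Qed.

Definition dual_zero : dual := additive_of dual_zero_sub.
Definition dual_opp f : dual := additive_of (dual_opp_sub f).
Definition dual_add f g : dual := additive_of (dual_add_sub f g).
Definition dual_scale r f : dual := additive_of (dual_scale_sub r f).

Fact dual_addA : associative dual_add.
Proof. by move=> f g h; apply: additive_ext => x /=; rewrite addrA. Qed.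
Fact dual_addC : commutative dual_add.
Proof. by move=> f g; apply: additive_ext => x /=; rewrite addrC. Qed.
Fact dual_add0 : left_id dual_zero dual_add.
Proof. by move=> f; apply: additive_ext => x /=; rewrite add0r. Qed.
Fact dual_addN : left_inverse dual_zero dual_opp dual_add.
Proof. by move=> f; apply: additive_ext => x /=; rewrite addNr. Qed.
HB.instance Definition _ := GRing.isZmodule.Build dual
  dual_addA dual_addC dual_add0 dual_addN.

Fact dual_scaleA a b f : dual_scale a (dual_scale b f) = dual_scale (a * b) f.
Proof. by apply: additive_ext => x /=; rewrite scalerA. Qed.
Fact dual_scale1 : left_id 1 dual_scale.
Proof.
by move=> f; apply: additive_ext => x /=; rewrite [X in dual_app _ X]scale1r.
Qed.
Fact dual_scaleDr : right_distributive dual_scale +%R.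
Proof. by move=> a f g; apply: additive_ext. Qed.
Fact dual_scaleDl f : {morph dual_scale^~ f : a b / a + b}.
Proof.
move=> a b; apply: additive_ext => x /=.
by rewrite [X in dual_app _ X]scalerDl raddfD.
Qed.
HB.instance Definition _ := GRing.Zmodule_isLmodule.Build R dual
  dual_scaleA dual_scale1 dual_scaleDr dual_scaleDl.
End Dual.

Lemma dual_ext (R : pzRingType) (A : lmodType R^c) (f g : dual A) :
  (forall x, dual_app f x = dual_app g x) -> f = g.
Proof. exact: additive_ext. Qed.

(** * Enough injectives and enough projectives *)

Section Cofree.
Context (R : pzRingType) (N : lmodType R).

(** [R^c^o] is R as a right module over itself, so this is a product of copies of Hom_Z(R, Q/Z). One
    copy for each character of [N] is enough to separate the elements of [N]. *)
Definition cofree : lmodType R :=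
  {additive N -> QZ} -> dual (R^c^o : lmodType R^c).

Fact cofree_emb_sub (n : N) (c : {additive N -> QZ}) :
  zmod_morphism (fun r : R^c^o => c ((r : R) *: n)).
Proof. by move=> x y; rewrite -raddfB -scalerBl. Qed.

Definition cofree_emb_fun (n : N) : cofree :=
  fun c => additive_of (cofree_emb_sub n c) : dual (R^c^o : lmodType R^c).

Fact cofree_emb_is_linear : linear cofree_emb_fun.
Proof.
move=> a x y; apply/funext => c; apply: dual_ext => r.
by rewrite /= scalerDr raddfD scalerA.
Qed.
Definition cofree_emb : {linear N -> cofree} := linear_of cofree_emb_is_linear.

Lemma cofree_emb_inj : injective cofree_emb.
Proof.
apply/linear_ker0_inj => n n0; apply: contrapT => nz.
(* Separation from the image of the zero map yields a character that is nonzero at [n]; its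
   coordinate is then evaluated at 1. *)
have [|c [_ cn]] := @char_separation N N (\0 : {additive N -> N}) n.
  by move=> [x /= x0]; apply: nz.
apply: cn; have := congr1 (fun f : cofree => dual_app (f c) (1 : R)) n0.
by rewrite /= scale1r.
Qed.

(* A homomorphism into Hom_Z(R, Q/Z) is determined by its composite with
   evaluation at 1, an arbitrary character. *)
Lemma cofree_injective : injective_mod cofree.
Proof.
move=> A B f g fI.
have ev1B c : zmod_morphism (fun a => dual_app (g a c) (1 : R)).
  by move=> x y; rewrite raddfB.
have ext c : exists d : {additive B -> QZ},
    forall a, d (f a) = dual_app (g a c) (1 : R).
  apply: (@char_factor _ _ f (additive_of (ev1B c))) => a.
  by rewrite -(raddf0 f) => /fI ->; rewrite raddf0.
have [d dP] := choice ext.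
have hB (b : B) c : zmod_morphism (fun r : R^c^o => d c ((r : R) *: b)).
  by move=> x y; rewrite -raddfB -scalerBl.
pose h (b : B) : cofree :=
  fun c => additive_of (hB b c) : dual (R^c^o : lmodType R^c).
have hL : linear h.
  move=> a x y; apply/funext => c; apply: dual_ext => r.
  by rewrite /= scalerDr raddfD scalerA.
exists (linear_of hL) => a; apply/funext => c; apply: dual_ext => r.
rewrite /= -linearZ dP linearZ /=; congr (dual_app _ _).
exact: (mul1r (r : R)).
Qed.
End Cofree.

Section Free.
Context (R : pzRingType) (T : Type).

Inductive free_term :=
| FreeGen of T | FreeZero | FreeOpp of free_term
| FreeAdd of free_term & free_term | FreeScale of R & free_term.

HB.instance Definition _ := gen_eqMixin free_term.
HB.instance Definition _ := gen_choiceMixin free_term.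

Fixpoint free_eval (B : lmodType R) (v : T -> B) (e : free_term) : B :=
  match e with
  | FreeGen t => v t
  | FreeZero => 0
  | FreeOpp e => - free_eval v e
  | FreeAdd e e' => free_eval v e + free_eval v e'
  | FreeScale a e => a *: free_eval v e
  end.

(* With terms identified when they agree in every module, the quotient inherits
   the module laws, and evaluation gives the universal property. *)
Definition free_rel : rel free_term := fun e e' =>
  `[< forall (B : lmodType R) (v : T -> B), free_eval v e = free_eval v e' >].

Fact free_rel_equiv : equiv_class_of free_rel.
Proof.
split=> [e|e e'|e e' e''].
- exact/asboolP.
- by apply/asboolP/asboolP => H B v; rewrite H.
- by move=> /asboolP H /asboolP H'; apply/asboolP => B v; rewrite H.
Qed.
Canonical free_equiv := EquivRelPack free_rel_equiv.

Definition free_mod : Type := {eq_quot free_equiv}.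
HB.instance Definition _ := Choice.on free_mod.

Definition free_pi (e : free_term) : free_mod := \pi_({eq_quot free_equiv}) e.
Definition free_lift_fun (B : lmodType R) (v : T -> B) (x : free_mod) : B :=
  free_eval v (repr (x : {eq_quot free_equiv})).

Lemma free_lift_pi (B : lmodType R) (v : T -> B) e :
  free_lift_fun v (free_pi e) = free_eval v e.
Proof. by rewrite /free_lift_fun; case: piP => e' /eqmodP/asboolP ->. Qed.

Lemma free_eq x y :
  (forall (B : lmodType R) (v : T -> B),
    free_lift_fun v x = free_lift_fun v y) ->
  x = y.
Proof.
move=> xy; rewrite -[x](@reprK _ {eq_quot free_equiv}).
rewrite -[y](@reprK _ {eq_quot free_equiv}).
by apply/eqmodP/asboolP.
Qed.

Definition free_rep (x : free_mod) : free_term :=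
  repr (x : {eq_quot free_equiv}).
Definition free_zero := free_pi FreeZero.
Definition free_opp x := free_pi (FreeOpp (free_rep x)).
Definition free_add x y := free_pi (FreeAdd (free_rep x) (free_rep y)).
Definition free_scale a x := free_pi (FreeScale a (free_rep x)).

Fact free_liftE0 (B : lmodType R) (v : T -> B) : free_lift_fun v free_zero = 0.
Proof. exact: free_lift_pi. Qed.
Fact free_liftEN (B : lmodType R) (v : T -> B) x :
  free_lift_fun v (free_opp x) = - free_lift_fun v x.
Proof. exact: free_lift_pi. Qed.
Fact free_liftED (B : lmodType R) (v : T -> B) x y :
  free_lift_fun v (free_add x y) = free_lift_fun v x + free_lift_fun v y.
Proof. exact: free_lift_pi. Qed.
Fact free_liftEZ (B : lmodType R) (v : T -> B) a x :
  free_lift_fun v (free_scale a x) = a *: free_lift_fun v x.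
Proof. exact: free_lift_pi. Qed.
Let free_liftE := (free_liftE0, free_liftEN, free_liftED, free_liftEZ).

Fact free_addA : associative free_add.
Proof. by move=> x y z; apply: free_eq => B v; rewrite !free_liftE addrA. Qed.
Fact free_addC : commutative free_add.
Proof. by move=> x y; apply: free_eq => B v; rewrite !free_liftE addrC. Qed.
Fact free_add0 : left_id free_zero free_add.
Proof. by move=> x; apply: free_eq => B v; rewrite !free_liftE add0r. Qed.
Fact free_addN : left_inverse free_zero free_opp free_add.
Proof. by move=> x; apply: free_eq => B v; rewrite !free_liftE addNr. Qed.
HB.instance Definition _ := GRing.isZmodule.Build free_mod
  free_addA free_addC free_add0 free_addN.

Fact free_scaleA a b x : free_scale a (free_scale b x) = free_scale (a * b) x.
Proof. by apply: free_eq => B v; rewrite !free_liftE scalerA. Qed.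
Fact free_scale1 : left_id 1 free_scale.
Proof. by move=> x; apply: free_eq => B v; rewrite !free_liftE scale1r. Qed.
Fact free_scaleDr : right_distributive free_scale +%R.
Proof.
by move=> a x y; apply: free_eq => B v; rewrite !free_liftE scalerDr.
Qed.
Fact free_scaleDl x : {morph free_scale^~ x : a b / a + b}.
Proof. by move=> a b; apply: free_eq => B v; rewrite !free_liftE scalerDl. Qed.
HB.instance Definition _ := GRing.Zmodule_isLmodule.Build R free_mod
  free_scaleA free_scale1 free_scaleDr free_scaleDl.

Fact free_lift_is_linear (B : lmodType R) (v : T -> B) :
  linear (free_lift_fun v).
Proof. by move=> a x y; rewrite free_liftED free_liftEZ. Qed.
Definition free_lift (B : lmodType R) (v : T -> B) : {linear free_mod -> B} :=
  linear_of (free_lift_is_linear v).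

Definition free_gen (t : T) : free_mod := free_pi (FreeGen t).

Lemma free_lift_gen (B : lmodType R) (v : T -> B) t :
  free_lift v (free_gen t) = v t.
Proof. exact: free_lift_pi. Qed.

(** The uniqueness half of the universal property, by induction on a term representing [x]. *)
Lemma free_liftP (B : lmodType R) (g : {linear free_mod -> B}) x :
  g x = free_lift (fun t => g (free_gen t)) x.
Proof.
rewrite -[x](@reprK _ {eq_quot free_equiv}); rewrite -[\pi_ _ _]/(free_pi _).
elim: (repr _) => [t||e IH|e IH e' IH'|a e IH].
- by rewrite free_lift_gen.
- by rewrite -[free_pi _]/(0 : free_mod) !raddf0.
- have -> : free_pi (FreeOpp e) = - free_pi e.
    by apply: free_eq => B' v; rewrite free_liftEN !free_lift_pi.
  by rewrite !linearN IH.
- have -> : free_pi (FreeAdd e e') = free_pi e + free_pi e'.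
    by apply: free_eq => B' v; rewrite free_liftED !free_lift_pi.
  by rewrite !linearD IH IH'.
- have -> : free_pi (FreeScale a e) = a *: free_pi e.
    by apply: free_eq => B' v; rewrite free_liftEZ !free_lift_pi.
  by rewrite !linearZ IH.
Qed.

Lemma free_projective : projective free_mod.
Proof.
move=> A B f g /choice[s sP].
exists (free_lift (fun t => s (g (free_gen t)))) => x.
rewrite -[LHS]/(hom_pre (free_lift _) f x) free_liftP [RHS]free_liftP.
congr free_lift_fun.
by apply/funext => t; apply: etrans (congr1 f (free_lift_gen _ t)) (sP _).
Qed.
End Free.

Definition free_cover (R : pzRingType) (N : lmodType R) :
  {linear free_mod R N -> N} := free_lift id.

Lemma free_cover_surj (R : pzRingType) (N : lmodType R) : surj (free_cover N).
Proof. by move=> x; exists (free_gen R x); apply: free_lift_gen. Qed.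

Definition exact_raug (R : pzRingType) (M : lmodType R) (U : raug_complex M) :=
  [/\ injective (raug U), exact_at (raug U) (rdiff U 0)
    & forall n, exact_at (rdiff U n) (rdiff U n.+1)].

Section ResolutionsExist.
Context (R : pzRingType) (M : lmodType R).

Fixpoint syzygy n : lmodType R :=
  if n is n'.+1 then kernel (free_cover (syzygy n')) else M.

(** Each differential is the free cover of a syzygy followed by the inclusion of that syzygy, so
    exactness comes from surjectivity of the first and injectivity of the second. *)
Lemma projective_resolution_exists :
  exists P : laug_complex M, resolution (@projective R) P.
Proof.
pose d n : {linear free_mod R (syzygy n.+1) -> free_mod R (syzygy n)} :=
  hom_pre (free_cover (syzygy n.+1)) (kernel_incl (free_cover (syzygy n))).
have dcover n x : free_cover (syzygy n) (d n x) = 0 by apply: kernel_inclK.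
have dK n x : d n (d n.+1 x) = 0.
  exact: etrans (congr1 _ (dcover n.+1 x)) (raddf0 _).
have dex n x : free_cover (syzygy n) x = 0 -> exists y, d n y = x.
  move=> /kernel_exists[k kx]; have [y yk] := free_cover_surj k.
  by exists y; apply: etrans (congr1 (kernel_incl _) yk) kx.
exists (@LaugComplex _ _ (fun n => free_mod R (syzygy n) : lmodType R)
  d (free_cover M) dK (dcover 0%N)); split=> [n|].
  exact: free_projective.
split=> /=; first exact: free_cover_surj.
  by split=> [x|y]; [apply: (dcover 0%N) | apply: (dex 0%N)].
move=> n; split=> [x|y]; first exact: dK.
move=> dy; apply: (dex n.+1).
apply: (@kernel_incl_inj _ _ _ (free_cover (syzygy n))).
by rewrite raddf0; apply: dy.
Qed.

Fixpoint cosyzygy n : lmodType R :=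
  if n is n'.+1 then coker (cofree_emb (cosyzygy n')) else M.

(** Dually, each differential is the projection onto a cokernel followed by its embedding in a
    cofree module. *)
Lemma injective_coresolution_exists :
  exists J : raug_complex M,
    (forall n, injective_mod (robj J n)) /\ exact_raug J.
Proof.
pose d n : {linear cofree (cosyzygy n) -> cofree (cosyzygy n.+1)} :=
  hom_pre (coker_pi (cofree_emb (cosyzygy n))) (cofree_emb (cosyzygy n.+1)).
have demb n x : d n (cofree_emb (cosyzygy n) x) = 0.
  have /coker_pi_eq0 e :
      exists y, cofree_emb (cosyzygy n) y = cofree_emb (cosyzygy n) x.
    by exists x.
  exact: etrans (congr1 (cofree_emb _) e) (raddf0 _).
have dK n x : d n.+1 (d n x) = 0 by apply: demb.
have dex n x : d n x = 0 -> exists y, cofree_emb (cosyzygy n) y = x.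
  rewrite /d /= -(raddf0 (cofree_emb (cosyzygy n.+1))) => /cofree_emb_inj.
  by move/coker_pi_eq0.
exists (@RaugComplex _ _ (fun n => cofree (cosyzygy n))
  d (cofree_emb M) dK (demb 0%N)); split=> [n|].
  exact: cofree_injective.
split=> /=; first exact: cofree_emb_inj.
  by split=> [x|y]; [apply: (demb 0%N) | apply: (dex 0%N)].
move=> n; split=> [x|y]; first exact: dK.
by move=> /(dex n.+1)[z <-]; have [x <-] := coker_pi_surj z; exists x.
Qed.
End ResolutionsExist.

(** * Balancing Ext and Tor *)

Section Balance.
Context (R : pzRingType) (M N : lmodType R).
Context (F : laug_complex M) (J : raug_complex N).

(** Vanishing of the cohomology of Hom(F, N) in degree n + 1 for all n, that is, in all positive
    degrees. *)
Definition hom_left_acyclic := forall n (g : {linear lobj F n.+1 -> N}),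
  (forall x, g (ldiff F n.+1 x) = 0) ->
  exists h : {linear lobj F n -> N}, forall x, h (ldiff F n x) = g x.

Definition hom_right_acyclic := forall p (g : {linear M -> robj J p.+1}),
  (forall x, rdiff J p.+1 (g x) = 0) ->
  exists h : {linear M -> robj J p}, forall x, rdiff J p (h x) = g x.

(** Exactness of Hom(L, J^+) from Hom(L, J^0) on; at Hom(L, N) injectivity of [raug J] takes over.
    Stated for a single [L], the condition fits projective modules with any exact [J] as well as
    flat modules with a complex of character modules. *)
Definition hom_exact (L : lmodType R) :=
  (forall g : {linear L -> robj J 0}, (forall x, rdiff J 0 (g x) = 0) ->
     exists h : {linear L -> N}, forall x, raug J (h x) = g x) /\
  (forall p (g : {linear L -> robj J p.+1}),
     (forall x, rdiff J p.+1 (g x) = 0) ->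
     exists h : {linear L -> robj J p}, forall x, rdiff J p (h x) = g x).

Hypothesis Fexact : exact_laug F.
Hypothesis Jinj : forall p, injective_mod (robj J p).
Hypothesis JaugI : injective (raug J).
Hypothesis FJ : forall n, hom_exact (lobj F n).

Let Jext n p (g : {linear lobj F n.+1 -> robj J p}) :
  (forall x, g (ldiff F n.+1 x) = 0) ->
  exists h : {linear lobj F n -> robj J p}, forall x, h (ldiff F n x) = g x.
Proof. by have [_ _ ex] := Fexact; apply: injective_extend. Qed.

(* Induction on p: g o d lifts to F_{n+1} -> J^{p-1}; straighten that lift,
   extend it along d, and subtract the extension from g. *)
Let straighten_left p : hom_left_acyclic ->
  forall n (g : {linear lobj F n -> robj J p}),
  (forall x, rdiff J p (g (ldiff F n x)) = 0) ->
  exists g' : {linear lobj F n -> robj J p},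
    (forall x, g' (ldiff F n x) = 0) /\
    forall x, rdiff J p (g' x) = rdiff J p (g x).
Proof.
move=> acy; elim: p => [|p IH] n g dgd.
  have [g1 g1P] := (FJ n.+1).1 (hom_pre (ldiff F n) g) dgd.
  have [|h hP] := acy n g1.
    move=> x; apply: JaugI; rewrite raddf0.
    by apply: etrans (g1P _) _; rewrite /= ldiffK raddf0.
  exists (g \- hom_pre h (raug J)); split=> x /=.
    by rewrite hP g1P subrr.
  by rewrite raddfB /= raugK subr0.
have [g1 g1P] := (FJ n.+1).2 p (hom_pre (ldiff F n) g) dgd.
have [|g1' [g1'd dg1']] := IH n.+1 g1.
  by move=> x; rewrite g1P /= ldiffK raddf0.
have [h hP] := Jext g1'd.
exists (g \- hom_pre h (rdiff J p)); split=> x /=.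
  by rewrite hP dg1' g1P subrr.
by rewrite raddfB /= rdiffK subr0.
Qed.

(** The mirror image, by induction on n: [rdiff J p \o g] extends along d to F_n -> J^{p+1};
    straighten that extension, lift it to J^p, and subtract from [g] the composite of the lift with
    d. *)
Let straighten_right n : hom_right_acyclic ->
  forall p (g : {linear lobj F n -> robj J p}),
  (forall x, rdiff J p (g (ldiff F n x)) = 0) ->
  exists g' : {linear lobj F n -> robj J p},
    (forall x, rdiff J p (g' x) = 0) /\
    forall x, g' (ldiff F n x) = g (ldiff F n x).
Proof.
have [Fsurj F0 Fn] := Fexact.
move=> acy; elim: n => [|n IH] p g dgd.
  have [|g1 g1P] := surj_descend (g := hom_pre g (rdiff J p)) Fsurj.
    by move=> x /F0.2[y <-]; apply: dgd.
  have [|h hP] := acy p g1.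
    by move=> x; have [y <-] := Fsurj x; rewrite g1P /= rdiffK.
  exists (g \- hom_pre (laug F) h); split=> x /=.
    by rewrite raddfB /= hP g1P subrr.
  by rewrite laugK raddf0 subr0.
have [g1 g1P] := Jext (g := hom_pre g (rdiff J p)) dgd.
have [|g1' [dg1' g1'd]] := IH p.+1 g1.
  by move=> x; rewrite g1P /= rdiffK.
have [h hP] := (FJ n).2 p g1' dg1'.
exists (g \- hom_pre (ldiff F n) h); split=> x /=.
  by rewrite raddfB /= hP g1'd g1P subrr.
by rewrite ldiffK raddf0 subr0.
Qed.

(** A cocycle is moved one step into the double complex Hom(F, J) and straightened there using the
    acyclicity assumed. It then descends to M in one direction, and lifts to N in the other. *)
Lemma hom_balance : hom_left_acyclic <-> hom_right_acyclic.
Proof.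
have [Fsurj F0 Fn] := Fexact.
split=> acy n g dg.
  have [|g0 g0P] := (FJ 0).2 n (hom_pre (laug F) g).
    by move=> x; apply: dg.
  have [|g' [g'd dg']] := straighten_left acy (g := g0).
    by move=> x; rewrite g0P /= laugK raddf0.
  have [|h hP] := surj_descend (g := g') Fsurj.
    by move=> x /F0.2[y <-].
  by exists h => x; have [y <-] := Fsurj x; rewrite hP dg' g0P.
have [|g0 g0P] := @Jext n 0%N (hom_pre g (raug J)).
  by move=> x /=; rewrite dg raddf0.
have [|g' [dg' g'd]] := straighten_right acy (g := g0).
  by move=> x; rewrite g0P /= raugK.
have [h hP] := (FJ n).1 g' dg'.
by exists h => x; apply: JaugI; rewrite hP g'd g0P.
Qed.
End Balance.

Lemma ext_vanishesP (R : pzRingType) (M N : lmodType R) :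
  ext_vanishes M N <->
    forall P : laug_complex M, resolution (@projective R) P ->
    hom_left_acyclic N P.
Proof.
split=> H P hP n.
  move=> g gd; have [|h hE] := (H P hP n).2 g; first exact: linear_ext.
  by exists h => x; rewrite -hE.
split=> [g|g gd]; first by apply: linear_ext => x /=; rewrite ldiffK raddf0.
have [|h hE] := H P hP n g; last by exists h; apply: linear_ext.
by move=> x; have := congr1 (fun f : {linear _ -> _} => f x) gd.
Qed.

Lemma projective_hom_exact (R : pzRingType) (N L : lmodType R)
    (J : raug_complex N) :
  exact_raug J -> projective L -> hom_exact J L.
Proof.
move=> [_ J0 Jn] projL; split=> [g|p g]; first exact: projective_lift.
exact: projective_lift.
Qed.

(** Balancing compares each projective resolution with the same [J], so the condition does not
    depend on the resolution; since one exists, the quantification over all of them is not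
    vacuous. *)
Lemma ext_vanishes_injective (R : pzRingType) (M N : lmodType R)
    (J : raug_complex N) :
  (forall p, injective_mod (robj J p)) -> exact_raug J ->
  ext_vanishes M N <-> hom_right_acyclic M J.
Proof.
move=> Jinj Jex; have [JI _ _] := Jex.
have bal (P : laug_complex M) : resolution (@projective R) P ->
    hom_left_acyclic N P <-> hom_right_acyclic M J.
  move=> [Pproj Pex]; apply: hom_balance => // n.
  exact: projective_hom_exact.
rewrite ext_vanishesP; split=> [H|H P hP]; last exact/bal.
by have [P hP] := projective_resolution_exists M; apply/(bal P hP)/H.
Qed.

(** * Characters of tensor products *)

Section TensorCharacters.
Context (R : pzRingType).
Implicit Types (A B D : lmodType R^c) (L P Q : lmodType R).

Fact dual_map_sub A B (f : {linear A -> B}) (c : dual B) :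
  zmod_morphism (fun x => dual_app c (f x)).
Proof. by move=> x y; rewrite !raddfB. Qed.
Definition dual_map_fun A B (f : {linear A -> B}) (c : dual B) : dual A :=
  additive_of (dual_map_sub f c).
Fact dual_map_is_linear A B (f : {linear A -> B}) : linear (dual_map_fun f).
Proof. by move=> r c d; apply: dual_ext => x; rewrite /= linearZ. Qed.
Definition dual_map A B (f : {linear A -> B}) : {linear dual B -> dual A} :=
  linear_of (dual_map_is_linear f).

Lemma exact_dual A B D (f : {linear A -> B}) (g : {linear B -> D}) :
  exact_at f g -> exact_at (dual_map g) (dual_map f).
Proof.
move=> fg; split=> [c|c cf].
  by apply: dual_ext => x /=; rewrite fg.1 raddf0.
have [|d dP] := ((exact_at_char fg.1).1 fg) (dual_app c).
  by move=> x; have := congr1 (fun c => dual_app c x) cf.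
by exists (d : dual D); apply: dual_ext.
Qed.

Section Adjunction.
Context (A : lmodType R^c) (L : lmodType R).

Fact hom_of_char_sub (c : {additive tensor A L -> QZ}) (p : L) :
  zmod_morphism (fun a : A => c (pure a p)).
Proof.
move=> x y; apply/eqP; rewrite eq_sym subr_eq -raddfD -pureDl; apply/eqP.
by rewrite subrK.
Qed.
Definition hom_of_char_fun c p : dual A := additive_of (hom_of_char_sub c p).
Fact hom_of_char_is_linear c : linear (hom_of_char_fun c).
Proof.
by move=> r x y; apply: dual_ext => a; rewrite /= pureDr raddfD -pureZ.
Qed.
Definition hom_of_char c : {linear L -> dual A} :=
  linear_of (hom_of_char_is_linear c).

(** The converse of [hom_of_char]; together they give the adjunction Hom_Z(A (x) L, Q/Z) = Hom_R(L,
    Hom_Z(A, Q/Z)). *)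
Lemma char_of_hom (h : {linear L -> dual A}) :
  exists c : {additive tensor A L -> QZ},
    forall a p, c (pure a p) = dual_app (h p) a.
Proof.
have BDl a b p : dual_app (h p) (a + b) = dual_app (h p) a + dual_app (h p) b.
  exact: raddfD.
have BDr a p q : dual_app (h (p + q)) a = dual_app (h p) a + dual_app (h q) a.
  by rewrite raddfD.
have BZ (r : R) a p : dual_app (h p) ((r : R^c) *: a) = dual_app (h (r *: p)) a.
  by rewrite linearZ.
exists (additive_of (tensor_lift_is_zmod_morphism BDl BDr BZ)) => a p.
exact: tensor_lift_pure BDl BDr BZ a p.
Qed.

Lemma char_ext (c d : {additive tensor A L -> QZ}) :
  (forall a p, c (pure a p) = d (pure a p)) -> c =1 d.
Proof. by apply: tensor_ext => x y; rewrite raddfB. Qed.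
End Adjunction.

Lemma tensor_map_comp0 A B D L P Q (f : {linear A -> B}) (g : {linear B -> D})
    (u : {linear L -> P}) (v : {linear P -> Q}) :
  (forall x, g (f x) = 0) \/ (forall x, v (u x) = 0) ->
  forall x, tensor_map g v (tensor_map f u x) = 0.
Proof.
move=> gf0; apply: (tensor_ext (f := tensor_map g v \o tensor_map f u)
  (g := fun=> 0)) => [x y|x y|a p] /=.
- by rewrite !raddfB.
- by rewrite subrr.
rewrite !tensor_map_pure; case: gf0 => ->.
  by apply: (addrI (pure 0 (v (u p)))); rewrite -pureDl !addr0.
by apply: (addrI (pure (g (f a)) 0)); rewrite -pureDr !addr0.
Qed.

(** Characters detect exactness, and by adjunction a character of a tensor product is a map into a
    character module. Here the right module varies; in [exact_tensor_rP] the left one does. *)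
Lemma exact_tensor_lP A B D L (f : {linear A -> B}) (g : {linear B -> D}) :
  (forall x, g (f x) = 0) ->
  exact_at (tensor_map f (idfun : {linear L -> L}))
           (tensor_map g (idfun : {linear L -> L})) <->
  forall h : {linear L -> dual B}, (forall p, dual_map f (h p) = 0) ->
    exists k : {linear L -> dual D}, forall p, dual_map g (k p) = h p.
Proof.
move=> gf0; rewrite (exact_at_char (tensor_map_comp0 (or_introl gf0))).
split=> [H h hf|H c cf].
  have [c cP] := char_of_hom h.
  have [|d dP] := H c.
    have gE := char_ext (c := c \o tensor_map f idfun) (d := \0).
    apply: gE => a p /=; rewrite tensor_map_pure cP.
    by have := congr1 (fun c => dual_app c a) (hf p).
  exists (hom_of_char d) => p; apply: dual_ext => b.
  by rewrite -cP -dP /= tensor_map_pure.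
have [|k kP] := H (hom_of_char c).
  move=> p; apply: dual_ext => a; have := cf (pure a p).
  by rewrite /= tensor_map_pure.
have [d dP] := char_of_hom k.
exists d; apply: (char_ext (c := d \o tensor_map g idfun)) => b p /=.
rewrite tensor_map_pure dP.
by have := congr1 (fun c => dual_app c b) (kP p).
Qed.

Lemma exact_tensor_rP A L P Q (f : {linear L -> P}) (g : {linear P -> Q}) :
  (forall x, g (f x) = 0) ->
  exact_at (tensor_map (idfun : {linear A -> A}) f)
           (tensor_map (idfun : {linear A -> A}) g) <->
  forall h : {linear P -> dual A}, (forall x, h (f x) = 0) ->
    exists k : {linear Q -> dual A}, forall x, k (g x) = h x.
Proof.
move=> gf0; rewrite (exact_at_char (tensor_map_comp0 (or_intror gf0))).
split=> [H h hf|H c cf].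
  have [c cP] := char_of_hom h.
  have [|d dP] := H c.
    have gE := char_ext (c := c \o tensor_map idfun f) (d := \0).
    by apply: gE => a p /=; rewrite tensor_map_pure cP hf.
  exists (hom_of_char d) => p; apply: dual_ext => b.
  by rewrite -cP -dP /= tensor_map_pure.
have [|k kP] := H (hom_of_char c).
  move=> p; apply: dual_ext => a; have := cf (pure a p).
  by rewrite /= tensor_map_pure.
have [d dP] := char_of_hom k.
exists d; apply: (char_ext (c := d \o tensor_map idfun g)) => b p /=.
by rewrite tensor_map_pure dP kP.
Qed.

(** Passing to characters turns flatness of [L] into lifting along an exact sequence of character
    modules. *)
Lemma projective_flat L : projective L -> flat L.
Proof.
move=> projL A B D f g fg; apply/exact_tensor_lP => [|h hf]; first exact: fg.1.
exact: projective_lift (exact_dual fg) hf.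
Qed.

End TensorCharacters.

(** * Finitely generated projectives and finite presentations *)

Section FinitelyGenerated.
Context (A : pzRingType).

(** The generators define a surjection from a finite free module onto [P]; the phi_i are the
    coordinates of a section of it. *)
Lemma dual_basis (P : lmodType A) : fin_gen P -> projective P ->
  exists n (e : 'I_n -> P) (phi : 'I_n -> {linear P -> A^o}),
    forall x, x = \sum_(i < n) (phi i x : A) *: e i.
Proof.
move=> [n [e eP]] projP.
have fL : linear (fun a : 'I_n -> A^o => \sum_(i < n) (a i : A) *: e i).
  move=> r a b; rewrite scaler_sumr -big_split; apply: eq_bigr => i _ /=.
  by rewrite scalerDl scalerA.
have [|h hP] := projP _ _ (linear_of fL) idfun.
  by move=> x; have [a ->] := eP x; exists a.
have hiL i : linear (fun x => h x i : A^o) by move=> r x y; rewrite linearP.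
by exists n, e, (fun i => linear_of (hiL i)) => x; rewrite -{1}[x]hP.
Qed.

(* The generators are the images of a dual basis (e_i, phi_i) of the degree 0
   term; the relations say that e_j = \sum_i phi_i(e_j) e_i and that the images
   of the generators of the degree 1 term vanish. *)
Lemma finite_presentation (X : lmodType A) : degreewise_finite X ->
  exists n (c : 'I_n -> X) (K : finType) (r : K -> 'I_n -> A),
  [/\ forall x, exists a : 'I_n -> A, x = \sum_(i < n) a i *: c i,
      forall k, \sum_(i < n) r k i *: c i = 0
    & forall (Y : lmodType A) (y : 'I_n -> Y),
        (forall k, \sum_(i < n) r k i *: y i = 0) ->
        exists h : {linear X -> Y}, forall i, h (c i) = y i].
Proof.
move=> [P [[Pproj [Psurj P0 _]] Pfg]].
have [n [e [phi eP]]] := dual_basis (Pfg 0%N) (Pproj 0%N).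
have [m [e' e'P]] := Pfg 1%N.
pose c i := laug P (e i).
pose r (k : 'I_n + 'I_m) (i : 'I_n) : A :=
  match k with
  | inl j => (i == j)%:R - phi i (e j)
  | inr k => phi i (ldiff P 0 (e' k))
  end.
have rl (Y : lmodType A) (y : 'I_n -> Y) j :
    \sum_(i < n) r (inl j) i *: y i =
    y j - \sum_(i < n) (phi i (e j) : A) *: y i.
  under eq_bigr do rewrite scalerBl; rewrite sumrB; congr (_ - _).
  rewrite (bigD1 j) //= eqxx scale1r big1 ?addr0 // => i /negPf ->.
  by rewrite scale0r.
exists n, c, ('I_n + 'I_m)%type, r; split=> [x|k|Y y ry].
- have [z <-] := Psurj x; exists (fun i => phi i z).
  rewrite {1}[z]eP linear_sum; apply: eq_bigr => i _.
  by rewrite linearZ.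
- have cE z : \sum_(i < n) (phi i z : A) *: c i = laug P z.
    by rewrite {2}[z]eP linear_sum; apply: eq_bigr => i _; rewrite linearZ.
  by case: k => k; rewrite ?rl cE ?subrr // laugK.
have hL : linear (fun z => \sum_(i < n) (phi i z : A) *: y i).
  move=> a u v; rewrite scaler_sumr -big_split; apply: eq_bigr => i _ /=.
  by rewrite linearP scalerDl scalerA.
have [|h hP] := surj_descend (g := linear_of hL) Psurj.
  move=> z /P0.2[w <-]; have [a ->] := e'P w.
  rewrite [X in linear_of hL X]linear_sum linear_sum big1 // => k _.
  by rewrite !linearZ; have /= -> := ry (inr k); rewrite scaler0.
exists h => j; rewrite hP /=; apply/eqP.
by rewrite eq_sym -subr_eq0 -rl ry.
Qed.
End FinitelyGenerated.

(** A dual basis (e_i, phi_i) of [Q] reduces [g] to the finitely many characters a |-> g(a)(e_i).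
    Each extends along [f] to some d_i, and the extension of [g] sends b to q |-> \sum_i
    d_i(phi_i(q) b). *)
Lemma dual_fg_projective_injective (R : pzRingType) (Q : lmodType R^c) :
  fin_gen Q -> projective Q -> injective_mod (dual Q).
Proof.
move=> Qfg Qproj A B f g fI.
have [n [e [phi eP]]] := dual_basis Qfg Qproj.
have gB i : zmod_morphism (fun a => dual_app (g a) (e i)).
  by move=> x y; rewrite raddfB.
have ext i : exists d : {additive B -> QZ},
    forall a, d (f a) = dual_app (g a) (e i).
  apply: (@char_factor _ _ f (additive_of (gB i))) => a.
  by rewrite -(raddf0 f) => /fI ->; rewrite raddf0.
have [d dP] := choice ext.
have hB (b : B) :
    zmod_morphism (fun q => \sum_(i < n) d i ((phi i q : R) *: b)).
  move=> x y; rewrite -sumrB; apply: eq_bigr => i _.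
  by rewrite raddfB scalerBl raddfB.
pose h b : dual Q := additive_of (hB b).
have hL : linear h.
  move=> r x y; apply: dual_ext => q.
  rewrite /= -big_split; apply: eq_bigr => i _ /=.
  by rewrite linearZ scalerDr raddfD scalerA.
exists (linear_of hL) => a; apply: dual_ext => q /=.
rewrite {2}[q]eP raddf_sum; apply: eq_bigr => i _.
by rewrite -linearZ dP linearZ.
Qed.

(** * Computing Tor by flat resolutions *)

Section Tor.
Context (R : pzRingType) (A : lmodType R^c).

Fact dual_complex_K (Q : laug_complex A) n c :
  dual_map (ldiff Q n.+1) (dual_map (ldiff Q n) c) = 0.
Proof. by apply: dual_ext => x /=; rewrite ldiffK raddf0. Qed.
Fact dual_complex_augK (Q : laug_complex A) c :
  dual_map (ldiff Q 0) (dual_map (laug Q) c) = 0.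
Proof. by apply: dual_ext => x /=; rewrite laugK raddf0. Qed.
Definition dual_complex (Q : laug_complex A) : raug_complex (dual A) :=
  @RaugComplex R (dual A) (fun n => dual (lobj Q n) : lmodType R)
    (fun n => dual_map (ldiff Q n)) (dual_map (laug Q))
    (@dual_complex_K Q) (@dual_complex_augK Q).

Lemma dual_complex_exact (Q : laug_complex A) :
  exact_laug Q -> exact_raug (dual_complex Q).
Proof.
move=> [Qsurj Q0 Qn]; split=> [c d cd||n]; try exact: exact_dual.
apply: dual_ext => x; have [y <-] := Qsurj x.
by have := congr1 (fun c => dual_app c y) cd.
Qed.

(** By adjunction, Hom(L, -) of the dual complex consists of the characters of Q (x) L, which
    flatness keeps exact. *)
Lemma flat_hom_exact (Q : laug_complex A) (L : lmodType R) :
  exact_laug Q -> flat L -> hom_exact (dual_complex Q) L.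
Proof.
move=> [Qsurj Q0 Qn] flatL; split=> [g|p g].
  exact: (exact_tensor_lP L Q0.1).1 (flatL _ _ _ _ _ Q0) g.
exact: (exact_tensor_lP L (Qn p).1).1 (flatL _ _ _ _ _ (Qn p)) g.
Qed.

Lemma hom_left_acyclic_tensor (M : lmodType R) (F : laug_complex M) :
  hom_left_acyclic (dual A) F <->
  forall n, exact_at (tensor_map (idfun : {linear A -> A}) (ldiff F n.+1))
                     (tensor_map (idfun : {linear A -> A}) (ldiff F n)).
Proof.
split=> H n; last by apply/exact_tensor_rP; [exact: ldiffK | exact: H].
by apply/exact_tensor_rP; [exact: ldiffK | exact: H].
Qed.

(* Both sides are equivalent to acyclicity of Hom(M, Q^+), for Q a resolution of
   A by finitely generated projectives, with Q^+ an injective coresolution of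
   the character module of A. *)
Lemma tor_vanishes_flat (M : lmodType R) (F : laug_complex M) :
  degreewise_finite A -> resolution (@flat R) F ->
  tor_vanishes A M <->
  forall n, exact_at (tensor_map (idfun : {linear A -> A}) (ldiff F n.+1))
                     (tensor_map (idfun : {linear A -> A}) (ldiff F n)).
Proof.
move=> [Q [[Qproj Qex] Qfg]] hF.
have Jex := dual_complex_exact Qex; have [JI _ _] := Jex.
have bal (P : laug_complex M) : resolution (@flat R) P ->
    hom_left_acyclic (dual A) P <-> hom_right_acyclic M (dual_complex Q).
  move=> [Pflat Pex]; apply: hom_balance => // n.
    exact: dual_fg_projective_injective.
  exact: flat_hom_exact.
have proj_flat (P : laug_complex M) :
    resolution (@projective R) P -> resolution (@flat R) P.
  by case=> Pproj Pex; split=> // n; apply: projective_flat.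
rewrite -hom_left_acyclic_tensor (bal F hF); split=> [H|H P hP].
  have [P hP] := projective_resolution_exists M.
  by apply/(bal P (proj_flat P hP))/hom_left_acyclic_tensor/H.
by apply/hom_left_acyclic_tensor/(bal P (proj_flat P hP)).
Qed.
End Tor.

(** * Tensor evaluation *)

Section PureSums.
Context (R : pzRingType) (A : lmodType R^c) (L : lmodType R).

Lemma pure0l p : pure (0 : A) (p : L) = 0.
Proof. by apply: (addrI (pure 0 p)); rewrite -pureDl !addr0. Qed.

Lemma pure0r a : pure (a : A) (0 : L) = 0.
Proof. by apply: (addrI (pure a 0)); rewrite -pureDr !addr0. Qed.

Lemma pure_suml (I : finType) (a : I -> A) (p : L) :
  pure (\sum_i a i) p = \sum_i pure (a i) p.
Proof.
apply: (big_morph (fun a => pure a p)) => [x y|].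
  exact: pureDl.
exact: pure0l.
Qed.

Lemma pure_sumr (I : finType) (a : A) (p : I -> L) :
  pure a (\sum_i p i) = \sum_i pure a (p i).
Proof.
by apply: (big_morph (pure a)) => [x y|]; [apply: pureDr | apply: pure0r].
Qed.

(** The sums on the left form a subgroup that contains all pure tensors, so a character vanishing on
    it is zero and cannot separate [t] from it. *)
Lemma tensor_gens n (c : 'I_n -> A) :
  (forall x, exists a : 'I_n -> R^c, x = \sum_(i < n) a i *: c i) ->
  forall t : tensor A L,
  exists v : 'I_n -> L, \sum_(i < n) pure (c i) (v i) = t.
Proof.
move=> cgen t.
have sumB : zmod_morphism (fun v : 'I_n -> L => \sum_(i < n) pure (c i) (v i)).
  move=> u v; rewrite -sumrB; apply: eq_bigr => i _.
  apply/eqP; rewrite eq_sym subr_eq -pureDr; apply/eqP; congr pure.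
  by rewrite /= subrK.
apply: contrapT => /(@char_separation _ _ (additive_of sumB))[d [dv dt]].
apply: dt; apply: (char_ext (d := \0)) => a p; have [b ->] := cgen a.
have := dv (fun i => (b i : R) *: p); rewrite /= pure_suml => <-.
by congr (d _); apply: eq_bigr => i _; rewrite pureZ.
Qed.
End PureSums.

(** * The adjunction Hom_S(C (x) V, I) = Hom_R(V, Hom_S(C, I)) and its counit *)

Section BimoduleAdjunction.
Context (S R : pzRingType) (C : bimodType S R).

Lemma btensor_scaleE (V : lmodType R) (s : S) (c : C) (v : V) :
  s *: (pure (c : rmod C) v : btensor C V) = pure (s *: c : rmod C) v.
Proof. exact: btensor_scale_pure. Qed.

Section Adjunction.
Context (V : lmodType R) (I : lmodType S).

Lemma btensor_hom_ext (f g : {linear btensor C V -> I}) :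
  (forall (c : C) v, f (pure (c : rmod C) v) = g (pure (c : rmod C) v)) ->
  f =1 g.
Proof.
move=> fg; apply: (tensor_ext (f := f) (g := g)) => [x y|x y|c v].
- exact: (raddfB f).
- exact: (raddfB g).
exact: fg.
Qed.

(** Leaves the type [bhom C I], which carries the R-module structure, so that its elements can be
    applied as S-linear maps. *)
Definition bhom_app (f : bhom C I) : {linear C -> I} := f.

Lemma bhom_app_sum (K : finType) (f : K -> bhom C I) x :
  bhom_app (\sum_k f k) x = \sum_k bhom_app (f k) x.
Proof. exact: (big_morph (fun f : bhom C I => bhom_app f x)). Qed.

Fact bhom_of_sub (f : {linear btensor C V -> I}) (v : V) :
  linear (fun c : C => f (pure (c : rmod C) v)).
Proof.
move=> s x y; rewrite -linearZ -raddfD; congr (f _).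
by rewrite btensor_scaleE -pureDl.
Qed.
Definition bhom_of_fun f v : bhom C I := linear_of (bhom_of_sub f v).
Fact bhom_of_is_linear f : linear (bhom_of_fun f).
Proof.
by move=> r x y; apply: linear_ext => c; rewrite /= pureDr raddfD -pureZ.
Qed.
Definition bhom_of f : {linear V -> bhom C I} :=
  linear_of (bhom_of_is_linear f).

Section Lift.
Context (h : {linear V -> bhom C I}).
Let app (c : rmod C) v : I := bhom_app (h v) c.
Fact bt_DlP a b v : app (a + b) v = app a v + app b v.
Proof. exact: raddfD. Qed.
Fact bt_DrP a u v : app a (u + v) = app a u + app a v.
Proof. by rewrite /app raddfD. Qed.
Fact bt_ZP (r : R) a v : app ((r : R^c) *: a) v = app a (r *: v).
Proof. by rewrite /app linearZ. Qed.
Fact bt_of_is_linear : linear (tensor_lift app : btensor C V -> I).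
Proof.
have appB := tensor_lift_is_zmod_morphism bt_DlP bt_DrP bt_ZP.
pose F := additive_of appB.
move=> s x y; rewrite -[tensor_lift app]/(F : btensor C V -> I).
rewrite raddfD; congr (_ + _).
move: x; apply: (tensor_ext (f := fun x : btensor C V => F (s *: x))
  (g := fun x => s *: F x)) => [x z|x z|c v].
- by rewrite scalerBr raddfB.
- by rewrite raddfB scalerBr.
rewrite btensor_scaleE /= !(tensor_lift_pure bt_DlP bt_DrP bt_ZP).
exact: linearZ.
Qed.
Definition bt_of : {linear btensor C V -> I} := linear_of bt_of_is_linear.
Lemma bt_ofE (c : C) v : bt_of (pure (c : rmod C) v) = bhom_app (h v) c.
Proof. exact: tensor_lift_pure bt_DlP bt_DrP bt_ZP c v. Qed.
End Lift.
End Adjunction.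

Lemma btensor_mapE (V W : lmodType R) (f : {linear V -> W}) (c : C) v :
  btensor_map C f (pure (c : rmod C) v) = pure (c : rmod C) (f v).
Proof. exact: tensor_map_pure. Qed.

(* The evaluation map c (x) f |-> f c. *)
Definition nu (I : lmodType S) : {linear btensor C (bhom C I) -> I} :=
  bt_of (idfun : {linear bhom C I -> bhom C I}).

Lemma nuE (I : lmodType S) (c : C) (f : bhom C I) :
  nu I (pure (c : rmod C) f) = bhom_app f c.
Proof. exact: bt_ofE. Qed.

Section Coordinates.
Context (K : finType) (N : lmodType S).
Definition fun_single_fun (k : K) (x : N) : K -> N :=
  fun j => if j == k then x else 0.
Fact fun_single_is_linear k : linear (fun_single_fun k).
Proof.
move=> s x y; apply/funext => j; rewrite /fun_single_fun /=.
rewrite -[RHS]/(s *: (if j == k then x else 0) + (if j == k then y else 0)).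
by case: eqP => // _; rewrite scaler0 addr0.
Qed.
Definition fun_single k : {linear N -> (K -> N)} :=
  linear_of (fun_single_is_linear k).

Lemma fun_singleE (v : K -> N) : \sum_k fun_single k (v k) = v.
Proof.
apply/funext => j; rewrite fct_sumE (bigD1 j) //= /fun_single_fun eqxx.
by rewrite big1 ?addr0 // => k; rewrite eq_sym => /negPf ->.
Qed.
End Coordinates.

Hypothesis hC : semidualizing C.

Let finpres := finite_presentation (semidualizing_a2 hC).

Let lhom_eq0 (s : S) n (c : 'I_n -> rmod C) :
  (forall x, exists a : 'I_n -> R^c, x = \sum_(i < n) a i *: c i) ->
  (forall i, s *: (c i : C) = 0) -> s = 0.
Proof.
move=> cgen sc; apply: (bij_inj (semidualizing_b1 hC)).
apply: linear_ext => x; have [a ->] := cgen x; rewrite !linear_sum.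
apply: eq_bigr => i _; rewrite !linearZ; congr (_ *: _).
by rewrite /= /lhomothety_fun sc scale0r.
Qed.

(* By the homothety isomorphism S = End(C_R), a finite presentation of C_R gives
   an exact sequence 0 -> S -> C^n -> C^K of left S-modules, to which the exact
   functor Hom_S(-, I) is applied. *)
Lemma nu_surj (I : lmodType S) : injective_mod I -> surj (nu I).
Proof.
move=> injI x; have [n [c [K [r [cgen _ _]]]]] := finpres.
have eL : linear (fun s : S^o => fun i : 'I_n => (s : S) *: (c i : C)).
  by move=> s u v; apply/funext => i /=; rewrite scalerDl scalerA.
have gL : linear (fun s : S^o => (s : S) *: x).
  by move=> s u v /=; rewrite scalerDl scalerA.
(* The map S -> I sending 1 to [x] extends along the embedding of S in C^n; the restrictions f_i of
   the extension to the summands satisfy \sum_i f_i(c_i) = x. *)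
have [|h hP] := injI _ _ (linear_of eL) (linear_of gL).
  apply/linear_ker0_inj => s s0; apply: (lhom_eq0 cgen) => i.
  have := congr1 (fun f : 'I_n -> C => f i) s0; exact.
pose f i : bhom C I := hom_pre (fun_single C i) h.
exists (\sum_(i < n) pure (c i) (f i)); rewrite linear_sum.
under eq_bigr do rewrite nuE.
rewrite -[RHS]scale1r -[RHS](hP 1) -[linear_of eL 1]fun_singleE linear_sum.
by apply: eq_bigr => i _; rewrite /= scale1r.
Qed.

(** Write an element of the kernel as \sum_i c_i (x) f_i. The f_i define a map C^n -> I that
    vanishes on S, hence factors through C^n -> C^K. This expresses each f_i as \sum_k r_ki g_k, and
    the relations \sum_i c_i r_ki = 0 then kill the tensor. *)
Lemma nu_inj (I : lmodType S) : injective_mod I -> injective (nu I).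
Proof.
move=> injI; have [n [c [K [r [cgen crel cuniv]]]]] := finpres.
apply/linear_ker0_inj => t; have [f <-] := tensor_gens cgen t.
rewrite linear_sum; under eq_bigr do rewrite nuE.
move=> fc0.
have eL : linear (fun s : S^o => fun i : 'I_n => (s : S) *: (c i : C)).
  by move=> s u v; apply/funext => i /=; rewrite scalerDl scalerA.
have rL : linear (fun v : 'I_n -> C =>
    fun k : K => \sum_(i < n) ract (v i) (r k i)).
  move=> s u v; apply/funext => k /=.
  rewrite -[RHS]/(s *: (\sum_(i < n) ract (u i) (r k i)) +
    \sum_(i < n) ract (v i) (r k i)).
  rewrite scaler_sumr -big_split; apply: eq_bigr => i _.
  by rewrite /= ractDl ractZ.
have fL : linear (fun v : 'I_n -> C => \sum_(i < n) bhom_app (f i) (v i)).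
  move=> s u v; rewrite scaler_sumr -big_split; apply: eq_bigr => i _.
  exact: linearP.
have er : exact_at (linear_of eL) (linear_of rL).
  split=> [s|v vr].
    apply/funext => k /=; under eq_bigr do rewrite ractZ.
    rewrite -scaler_sumr (_ : \sum_(i < n) _ = 0) ?scaler0 //.
    exact: crel k.
  (* A tuple that satisfies the relations is the image of the generators under an endomorphism of
     C_R, which is a homothety by an element of S. *)
  have [k|h hP] := cuniv (rmod C : lmodType R^c) v.
    by have := congr1 (fun u : K -> C => u k) vr; exact.
  have [lh _ lhK] := semidualizing_b1 hC.
  exists (lh h); apply/funext => i; rewrite -hP /=.
  by rewrite -[in RHS](lhK h).
have [|g gP] := injective_extend injI er (h := linear_of fL).
  move=> s /=; under eq_bigr do rewrite linearZ.
  by rewrite -scaler_sumr fc0 scaler0.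
pose gk k : bhom C I := hom_pre (fun_single C k) g.
have fE i : f i = \sum_k (r k i : R) *: gk k.
  apply: linear_ext => x.
  have rx : linear_of rL (fun_single C i x) = fun k => ract x (r k i).
    apply/funext => k /=.
    rewrite (bigD1 i) //= /fun_single_fun eqxx big1 ?addr0 //.
    by move=> j /negPf ->; apply: (raddf0 (rhomothety C (r k j))).
  have := gP (fun_single C i x).
  rewrite rx -[fun k => _]fun_singleE linear_sum /=.
  have -> : \sum_(j < n) bhom_app (f j) (fun_single_fun i x j) =
      bhom_app (f i) x.
    rewrite (bigD1 i) //= /fun_single_fun eqxx big1 ?addr0 //.
    by move=> j /negPf ->; apply: raddf0.
  move=> gE.
  by rewrite -[LHS]gE -[RHS]/(bhom_app _ x) bhom_app_sum.
under eq_bigr do rewrite fE pure_sumr.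
rewrite exchange_big big1 //= => k _.
under eq_bigr do rewrite -pureZ.
by rewrite -pure_suml crel pure0l.
Qed.

Lemma nu_bij (I : lmodType S) : injective_mod I -> bijective (nu I).
Proof.
by move=> injI; apply: inj_surj_bijective; [apply: nu_inj | apply: nu_surj].
Qed.

End BimoduleAdjunction.

(** * The Auslander class and complete resolutions *)

Section Splicing.
Context (U V W X Y : zmodType).
Context (d : {additive U -> V}) (p : {additive V -> W}) (u : {additive W -> X})
        (e : {additive X -> Y}) (up : V -> X).
Hypothesis upE : forall x, up x = u (p x).
Hypotheses (p_surj : surj p) (dp : exact_at d p).

(** As [p] is the cokernel of [d], only injectivity of [u] is at stake. The map [up] is only
    pointwise the composite of [p] and [u], so that C (x) (u \o p) is covered too. *)
Lemma exact_splice_left : exact_at d up <-> (forall x, u x = 0 -> x = 0).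
Proof.
split=> [[_ H] w uw|u0].
  have [v vw] := p_surj w; have [|x xv] := H v; first by rewrite upE vw.
  by rewrite -vw -xv dp.1.
split=> [x|y]; first by rewrite upE dp.1 raddf0.
by rewrite upE => /u0/dp.2.
Qed.

Lemma exact_splice_right : exact_at up e <-> exact_at u e.
Proof.
split=> -[H1 H2]; split=> [x|y /H2[x <-]].
- by have [v <-] := p_surj x; rewrite -upE.
- by exists (p x); rewrite -upE.
- by rewrite upE.
- by have [v vx] := p_surj x; exists v; rewrite upE vx.
Qed.
End Splicing.

(** * Behaviour of C-injective modules and coresolutions under C (x) - *)

Section TensorHom.
Context (S R : pzRingType) (C : bimodType S R).
Implicit Types V W X : lmodType R.

Lemma btensor_map_comp V W X (f : {linear V -> W}) (g : {linear W -> X})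
    (h : {linear V -> X}) :
  (forall x, h x = g (f x)) ->
  forall t, btensor_map C h t = btensor_map C g (btensor_map C f t).
Proof.
move=> hE.
apply: (btensor_hom_ext (g := hom_pre (btensor_map C f) (btensor_map C g))).
by move=> c v; rewrite [RHS]/= !btensor_mapE hE.
Qed.

Lemma btensor_map_id V (f : {linear V -> V}) :
  (forall x, f x = x) -> forall t, btensor_map C f t = t.
Proof.
move=> fE; apply: (btensor_hom_ext (g := idfun)).
by move=> c v; rewrite btensor_mapE fE.
Qed.

Lemma btensor_map0 V W (f : {linear V -> W}) :
  (forall x, f x = 0) -> forall t, btensor_map C f t = 0.
Proof.
move=> f0; apply: (btensor_hom_ext (g := \0)).
by move=> c v; rewrite btensor_mapE f0; apply: pure0r.
Qed.

Lemma btensor_map_bij V W (f : {linear V -> W}) :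
  bijective f -> bijective (btensor_map C f).
Proof.
move=> /bijective_linear_inv[g [fK gK]]; exists (btensor_map C g) => t.
  rewrite -(btensor_map_comp (h := idfun) (fun x => esym (fK x))).
  exact: btensor_map_id.
rewrite -(btensor_map_comp (h := idfun) (fun x => esym (gK x))).
exact: btensor_map_id.
Qed.

(** The cokernel of C (x) f embeds in an injective module. The adjoint of the resulting map on C (x)
    W extends along [g] by assumption, so an element killed by C (x) g is zero in the cokernel. *)
Lemma exact_btensor V W X (f : {linear V -> W}) (g : {linear W -> X}) :
  (forall x, g (f x) = 0) ->
  (forall I : lmodType S, injective_mod I ->
     forall h : {linear W -> bhom C I}, (forall x, h (f x) = 0) ->
     exists k : {linear X -> bhom C I}, forall y, k (g y) = h y) ->
  exact_at (btensor_map C f) (btensor_map C g).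
Proof.
move=> gf H; split=> [|y gy]; first exact: btensor_map_comp0.
pose q := coker_pi (btensor_map C f).
pose i := cofree_emb (coker (btensor_map C f)).
have [|k kP] := H _ (@cofree_injective _ _) (bhom_of (hom_pre q i)).
  move=> x; apply: linear_ext => c; rewrite [LHS]/= -btensor_mapE.
  have /coker_pi_eq0 qE : exists t, btensor_map C f t =
    btensor_map C f (pure (c : rmod C) x) by exists (pure (c : rmod C) x).
  exact: etrans (congr1 i qE) (raddf0 i).
have kg t : bt_of k (btensor_map C g t) = i (q t).
  move: t; apply: (btensor_hom_ext (f := hom_pre (btensor_map C g) (bt_of k))
    (g := hom_pre q i)) => c v.
  by rewrite [LHS](congr1 (bt_of k) (btensor_mapE g c v)) bt_ofE kP.
apply/coker_pi_eq0/(@cofree_emb_inj _ (coker (btensor_map C f))).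
by rewrite raddf0; have := kg y; rewrite gy raddf0 => /esym.
Qed.

Lemma btensor_map_surj V W (f : {linear V -> W}) :
  surj f -> surj (btensor_map C f).
Proof.
move=> fS t.
have [|_ ex] := @exact_btensor _ _ _ f (\0 : {linear W -> W}) (fun=> erefl).
  move=> I _ h hf; exists \0 => y /=.
  by have [x <-] := fS y; rewrite hf.
by apply: ex; apply: btensor_map0.
Qed.

Lemma btensor_right_exact V W X (f : {linear V -> W}) (g : {linear W -> X}) :
  exact_at f g -> surj g -> exact_at (btensor_map C f) (btensor_map C g).
Proof.
move=> [gf fg] gS; apply: exact_btensor => // I _ h hf.
by apply: surj_descend => // x /fg[y <-].
Qed.

Lemma mu_natural V W (f : {linear V -> W}) v c :
  bhom_app (mu C W (f v)) c = btensor_map C f (bhom_app (mu C V v) c).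
Proof. by rewrite [RHS]btensor_mapE. Qed.

Lemma mu_bij_iso V W : lmod_iso V W -> bijective (mu C W) -> bijective (mu C V).
Proof.
move=> [f fbij] [mu' muK mu'K].
have Tinj := bij_inj (btensor_map_bij fbij).
apply: inj_surj_bijective => [x y xy|a].
  apply: (bij_inj fbij); apply: (can_inj muK); apply: linear_ext => c.
  rewrite -[LHS]/(bhom_app (mu C W (f x)) c) -[RHS]/(bhom_app (mu C W (f y)) c).
  by rewrite !mu_natural xy.
have [g fK gK] := fbij.
exists (g (mu' (hom_pre a (btensor_map C f) : bhom C (btensor C W)))).
apply: linear_ext => c; apply: Tinj.
rewrite -[mu C V _ c]/(bhom_app (mu C V _) c) -mu_natural gK mu'K.
by [].
Qed.

Section HomPost.
Context (I J : lmodType S) (f : {linear I -> J}).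
Definition bhom_post_fun (a : bhom C I) : bhom C J := hom_pre a f.
Fact bhom_post_is_linear : linear bhom_post_fun.
Proof. by move=> r a b; apply: linear_ext => c; rewrite /= raddfD. Qed.
Definition bhom_post : {linear bhom C I -> bhom C J} :=
  linear_of bhom_post_is_linear.

Lemma nu_natural t : nu C J (btensor_map C bhom_post t) = f (nu C I t).
Proof.
move: t; apply: (btensor_hom_ext
  (f := hom_pre (btensor_map C bhom_post) (nu C J))
  (g := hom_pre (nu C I) f)) => c a.
rewrite [LHS](congr1 (nu C J) (btensor_mapE bhom_post c a)) nuE.
exact: esym (congr1 f (nuE c a)).
Qed.
End HomPost.

Fact tensor_raug_K (M : lmodType R) (U : raug_complex M) :
  forall x, btensor_map C (rdiff U 0) (btensor_map C (raug U) x) = 0.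
Proof. exact: btensor_map_comp0 (@raugK _ _ U). Qed.
Definition tensor_raug (M : lmodType R) (U : raug_complex M) :
    raug_complex (btensor C M : lmodType S) :=
  @RaugComplex S (btensor C M) (fun n => btensor C (robj U n) : lmodType S)
    (fun n => btensor_map C (rdiff U n)) (btensor_map C (raug U))
    (fun n => btensor_map_comp0 (@rdiffK _ _ U n)) (@tensor_raug_K M U).

Lemma proper_tensor_exact (M : lmodType R) (U : raug_complex M) :
  proper_coresolution C U -> exact_raug (tensor_raug U).
Proof.
move=> [_ proper].
have cinj (I : lmodType S) : injective_mod I ->
  C_injective C (bhom C I : lmodType R).
  by move=> injI; exists I; split=> //; exists idfun; exists idfun.
split=> [||n].
- apply/linear_ker0_inj => t t0.
  (* Injectivity of C (x) M -> C (x) U^0 is obtained as exactness after a zero map. *)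
  have [|_ ex] := @exact_btensor _ _ _ (\0 : {linear M -> M}) (raug U)
    (fun=> raddf0 _).
    move=> I /cinj/proper[Hs _ _] h _; have [k <-] := Hs h.
      by exists k.
  have [x <-] := ex t t0; exact: btensor_map0.
- apply: exact_btensor => [|I /cinj/proper[_ [_ Hs] _] h hf].
    exact: raugK.
  have [|k <-] := Hs h; first exact: linear_ext.
  by exists k.
apply: exact_btensor => [|I /cinj/proper[_ _ /(_ n)[_ Hs]] h hf].
  exact: rdiffK.
have [|k <-] := Hs h; first exact: linear_ext.
by exists k.
Qed.

Hypothesis hC : semidualizing C.

(** Composition with [nu] is a left inverse of [mu] by a triangle identity; it is a right inverse
    too because [nu] is injective. *)
Lemma mu_bhom_bij (I : lmodType S) : injective_mod I ->
  bijective (mu C (bhom C I)).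
Proof.
move=> injI; have nuI := nu_inj hC injI.
apply: inj_surj_bijective => [f g fg|a].
  apply: linear_ext => c; rewrite -[LHS](nuE c) -[RHS](nuE c); congr (nu C I _).
  by have := congr1 (fun h => bhom_app h c) fg; exact.
exists (hom_pre a (nu C I)); apply: linear_ext => c; apply: nuI.
exact: nuE.
Qed.

Lemma C_injective_mu V : C_injective C V -> bijective (mu C V).
Proof. by move=> [I [injI VI]]; apply: mu_bij_iso VI _; apply: mu_bhom_bij. Qed.

Lemma C_injective_btensor V : C_injective C V -> injective_mod (btensor C V).
Proof.
move=> [I [injI [f fbij]]]; apply: (@lmod_iso_injective _ _ I) => //.
exists (hom_pre (btensor_map C f) (nu C I)).
by apply: (@bij_comp _ _ _ (nu C I)); [exact: nu_bij | exact: btensor_map_bij].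
Qed.

(** Apply Hom_S(C, -) to an injective coresolution J of C (x) M and augment by [mu]. Tensoring with
    C gives back J, by the isomorphisms [nu] and their naturality. *)
Lemma tensor_exact_coresolution_exists (M : lmodType R) :
  exists U : raug_complex M, (forall n, C_injective C (robj U n)) /\
    exact_raug (tensor_raug U).
Proof.
have [J [injJ [J0 J1 Jn]]] :=
  injective_coresolution_exists (btensor C M : lmodType S).
have dK n x : bhom_post (rdiff J n.+1) (bhom_post (rdiff J n) x) = 0.
  by apply: linear_ext => c /=; rewrite rdiffK.
pose a : {linear M -> bhom C (robj J 0)} :=
  hom_pre (mu C M) (bhom_post (raug J)).
have aK x : bhom_post (rdiff J 0) (a x) = 0.
  by apply: linear_ext => c /=; rewrite raugK.
pose U := @RaugComplex _ _ (fun n => bhom C (robj J n) : lmodType R)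
  (fun n => bhom_post (rdiff J n)) a dK aK.
exists U; split=> [n|].
  by exists (robj J n); split=> //; exists idfun; exists idfun.
have nu0 n t : nu C (robj J n) t = 0 -> t = 0.
  by rewrite -(raddf0 (nu C (robj J n))) => /(nu_inj hC (injJ n)).
have nua t : nu C (robj J 0) (btensor_map C a t) = raug J t.
  move: t; apply: (btensor_hom_ext (f := hom_pre (btensor_map C a) (nu C _))
    (g := raug J)) => c m.
  by rewrite [LHS](congr1 (nu C _) (btensor_mapE a c m)) nuE.
have nuS n := nu_surj hC (injJ n).
split=> [s t st||n].
- by apply: J0; rewrite -!nua; congr (nu C _ _).
- split=> [t|t dt]; first exact: tensor_raug_K.
  have [|y yt] := J1.2 (nu C _ t).
    by rewrite -nu_natural [X in nu C _ X]dt raddf0.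
  by exists y; apply: (nu_inj hC (injJ 0%N)); rewrite nua.
split=> [t|t dt]; first exact: (btensor_map_comp0 (dK n)).
have [|y yt] := (Jn n).2 (nu C _ t).
  by rewrite -nu_natural [X in nu C _ X]dt raddf0.
have [x xy] := nuS n y; exists x; apply: (nu_inj hC (injJ n.+1)).
by rewrite nu_natural xy.
Qed.

(** Through [mu], elements of U^n are the maps C -> C (x) U^n. Hence acyclicity of Hom_S(C, C (x) U)
    in positive degrees is exactness of U beyond U^0, while bijectivity of [mu C M] is exactness at
    M and at U^0. *)
Lemma coresolution_exactP (M : lmodType R) (U : raug_complex M) :
  (forall n, C_injective C (robj U n)) -> exact_raug (tensor_raug U) ->
  (ext_vanishes (C : lmodType S) (btensor C M) /\ bijective (mu C M)) <->
  exact_raug U.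
Proof.
move=> UC TU.
have Jinj n : injective_mod (robj (tensor_raug U) n).
  exact: C_injective_btensor.
rewrite (ext_vanishes_injective C Jinj TU).
have muB n := C_injective_mu (UC n).
have muI n : injective (mu C (robj U n)) := bij_inj (muB n).
have muS n (a : {linear C -> btensor C (robj U n)}) :
    exists x, forall c, bhom_app (mu C (robj U n) x) c = a c.
  by have [g _ gK] := muB n; exists (g a) => c; rewrite gK.
have mu_eq n (x y : robj U n) :
    (forall c, bhom_app (mu C _ x) c = bhom_app (mu C _ y) c) -> x = y.
  by move=> xy; apply: muI; apply: linear_ext.
have [T0 T1 Tn] := TU.
have acyP : hom_right_acyclic C (tensor_raug U) <->
    forall n, exact_at (rdiff U n) (rdiff U n.+1).
  split=> [acy n|ex n g dg].
    split=> [x|y dy]; first exact: rdiffK.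
    have [|h hP] := acy n (bhom_app (mu C _ y)).
      by move=> c; rewrite -[LHS]mu_natural dy raddf0.
    have [x xP] := muS n h; exists x; apply: mu_eq => c.
    by rewrite mu_natural xP; apply: hP.
  have [y yP] := muS n.+1 g.
  have [|x xy] := (ex n).2 y.
    by apply: mu_eq => c; rewrite mu_natural yP [LHS]dg raddf0.
  exists (bhom_app (mu C _ x)) => c; rewrite -yP -xy.
  by rewrite [RHS]mu_natural.
rewrite acyP; split=> [[ex muM]|[U0 U1 Un]].
  split=> //.
    apply/linear_ker0_inj => m um; apply: (bij_inj muM); apply: linear_ext => c.
    apply: T0; rewrite -[LHS](mu_natural (raug U)) um.
    by rewrite !raddf0.
  split=> [x|y dy]; first exact: raugK.
  have [|a aP] := inj_corestrict (g := bhom_app (mu C _ y)) T0.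
    move=> c; apply: T1.2; rewrite -[LHS](mu_natural (rdiff U 0)) dy.
    by rewrite raddf0.
  have [g _ gK] := muM; exists (g a); apply: mu_eq => c.
  by rewrite mu_natural gK; apply: aP.
split=> //; apply: inj_surj_bijective => [m n mn|a].
  by apply: U0; apply: mu_eq => c; rewrite !mu_natural mn.
have [y yP] := muS 0%N (hom_pre a (raug (tensor_raug U))).
have [|m my] := U1.2 y.
  by apply: mu_eq => c; rewrite mu_natural yP raddf0; apply: T1.1.
exists m; apply: linear_ext => c; apply: T0.
rewrite -[RHS]/(hom_pre a (raug (tensor_raug U)) c) -yP -my.
by rewrite [RHS]mu_natural.
Qed.

End TensorHom.

(** * Splicing and cutting complete resolutions *)

Section CompleteResolutions.
Context (S R : pzRingType) (C : bimodType S R) (hC : semidualizing C).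
Context (M : lmodType R).

(** Asking that C (x) U^+ be exact, instead of that [U] be proper, covers both the proper
    coresolutions and the one built from an injective coresolution of C (x) M. *)
Lemma auslander_splice (K : lmodType R -> Prop) (P : laug_complex M)
    (U : raug_complex M) :
  (forall L, K L -> flat L) -> auslander C M -> resolution K P ->
  (forall n, C_injective C (robj U n)) -> exact_raug (tensor_raug C U) ->
  complete_resolution C K M (splice P U).
Proof.
move=> Kflat [A1 A2 A3] [PK Pex] UC TU.
have [U0 U1 Un] : exact_raug U by apply/(coresolution_exactP hC UC TU).
have [P0 P1 Pn] := Pex.
have Pflat : resolution (@flat R) P by split=> // n; apply/Kflat/PK.
have [T0 T1 Tn] := TU.
split=> //.
- split=> //.
    by apply/(exact_splice_left (fun=> erefl) P0 P1)/linear_ker0_inj.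
  by apply/(exact_splice_right _ (fun=> erefl) P0).
- apply: lmod_iso_sym.
  have [|f fP] := surj_descend (g := laug P) (@coker_pi_surj _ _ _ (ldiff P 0)).
    by move=> x /coker_pi_eq0[y <-]; apply: laugK.
  exists f; apply: inj_surj_bijective => [|m].
    apply/linear_ker0_inj => z; have [x <-] := coker_pi_surj z.
    by rewrite fP => /P1.2 ?; apply/coker_pi_eq0.
  by have [x <-] := P0 m; exists (coker_pi _ x).
have midE := btensor_map_comp (C := C) (f := laug P) (g := raug U)
  (h := splice_mid P U) (fun=> erefl).
have P1' := btensor_right_exact C P1 P0.
have P0' := btensor_map_surj (C := C) P0.
split=> //.
- exact/(tor_vanishes_flat (semidualizing_a2 hC) Pflat).
- by apply/(exact_splice_left midE P0' P1')/linear_ker0_inj.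
by apply/(exact_splice_right _ midE P0').
Qed.

(** Cut X at M into a flat resolution P and a coresolution U. Exactness of C (x) X then gives the
    vanishing of Tor on the side of P, and exactness of C (x) U^+ on the other. *)
Lemma complete_resolution_auslander (X : complex R) :
  complete_resolution C (@flat R) M X -> auslander C M.
Proof.
move=> [[Xl Xml Xmr Xr] Pflat UC Miso [Tl Tml Tmr Tr]].
have [f fbij] := lmod_iso_sym Miso.
pose p : {linear cleft X 0 -> M} := hom_pre (coker_pi (dleft X 0)) f.
have p0 x : p x = 0 <-> exists y, dleft X 0 y = x.
  rewrite -coker_pi_eq0; split=> [|px];
    last exact: etrans (congr1 f px) (raddf0 f).
  by rewrite -(raddf0 f) => /(bij_inj fbij).
have pK x : p (dleft X 0 x) = 0 by apply/p0; exists x.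
have pS : surj p.
  move=> m; have [g _ gK] := fbij; have [x xm] := coker_pi_surj (g m).
  by exists x; apply: etrans (congr1 f xm) (gK m).
have pex : exact_at (dleft X 0) p by split=> // y /p0.
have [|u uE] := surj_descend (g := dmid X) pS.
  by move=> x /p0[y <-]; apply: dmidKl.
have uK m : dright X 0 (u m) = 0 by have [x <-] := pS m; rewrite uE dmidKr.
pose P := LaugComplex (@dleftK _ X) pK.
pose U := RaugComplex (@drightK _ X) uK.
have Pres : resolution (@flat R) P by split.
have midE := btensor_map_comp (C := C) (f := p) (g := u)
  (h := dmid X) (fun x => esym (uE x)).
(* By right exactness, C (x) M is again the cokernel at the cut, so C (x) X can be cut in the same
   way as X. *)
have pex' := btensor_right_exact C pex pS.
have pS' := btensor_map_surj (C := C) pS.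
have TU : exact_raug (tensor_raug C U).
  split=> //.
    by apply/linear_ker0_inj/(exact_splice_left midE pS' pex').
  by apply/(exact_splice_right _ midE pS').
have [|A2 A3] := (coresolution_exactP hC (U := U) UC TU).2.
  split=> //.
    by apply/linear_ker0_inj/(exact_splice_left (fun x => esym (uE x)) pS pex).
  by apply/(exact_splice_right _ (fun x => esym (uE x)) pS).
by split=> //; apply/(tor_vanishes_flat (semidualizing_a2 hC) Pres).
Qed.

End CompleteResolutions.

Theorem theorem2 (S R : pzRingType) (C : bimodType S R)
    (hC : semidualizing C) (M : lmodType R) :
  [/\ auslander C M <->
        exists X : complex R, complete_resolution C (@projective R) M X,
      auslander C M <->
        exists X : complex R, complete_resolution C (@flat R) M X,
      auslander C M ->
        forall (P : laug_complex M) (U : raug_complex M),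
          resolution (@projective R) P -> proper_coresolution C U ->
          complete_resolution C (@projective R) M (splice P U)
    & auslander C M ->
        forall (P : laug_complex M) (U : raug_complex M),
          resolution (@flat R) P -> proper_coresolution C U ->
          complete_resolution C (@flat R) M (splice P U)].
Proof.
have pf (L : lmodType R) : projective L -> flat L by apply: projective_flat.
have ff (L : lmodType R) : flat L -> flat L by [].
(* A projective complete resolution is also a flat one. So one converse, for flat modules, and one
   construction, with projective modules, settle both equivalences. *)
have cw X : complete_resolution C (@projective R) M X ->
    complete_resolution C (@flat R) M X.
  by case=> Xex Pproj *; split=> // n; apply/pf/Pproj.
have ex : auslander C M ->
    exists X : complex R, complete_resolution C (@projective R) M X.
  move=> hM; have [P hP] := projective_resolution_exists M.
  have [U [UC TU]] := tensor_exact_coresolution_exists hC M.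
  by exists (splice P U); apply: auslander_splice.
split.
- by split=> // -[X /cw]; apply: complete_resolution_auslander.
- split=> [/ex[X /cw hX]|[X]]; first by exists X.
  exact: complete_resolution_auslander.
- move=> hM P U hP hU; apply: auslander_splice => //; first exact: hU.1.
  exact: proper_tensor_exact hU.
- move=> hM P U hP hU; apply: auslander_splice => //; first exact: hU.1.
  exact: proper_tensor_exact hU.
Qed.
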